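(* Let $E$ be an exact Courant algebroid over a smooth manifold $M$, let $G$ be a compact connected Lie group with Lie algebra $\mathfrak g$ acting on $M$, let $(\mathcal A,\chi)$ be an isotropic $G$-lifted action on $E$, let $N\subset M$ be a $G$-invariant submanifold on which $G$ acts freely, and let $K\subset E|_N$ be the isotropic subbundle defined in the context. Let $L\subset E$ be an invariant Dirac structure. Suppose $L|_N\cap K$ has constant rank and let $D\subset E|_N$ be a perturbation input for $(L,K)$, i.e. an invariant isotropic subbundle with $(L|_N\cap K)^\perp\oplus D=E|_N$. Then $$L_D:=L|_N\cap D^\perp+D$$ is a Lagrangian subbundle of $E|_N$ such that (i) $L_D$ is invariant and $L_D\cap K=0$; (ii) $L_D\cap K^\perp+K=L|_N\cap K^\perp+K$. Moreover, let $\nabla$ be any isotropic splitting of $E$, let $\varphi$ be a nowhere-zero section of $U_\nabla(L|_N)$ over some open set $\mathcal V\subset N$, and suppose there exists a nowhere-zero section $\mathfrak d$ of $\det(D)$ over $\mathcal V$. Then $$\varphi_D=\Pi_\nabla(\mathfrak d)\varphi$$ is a nowhere-zero section of $U_\nabla(L_D)$ over $\mathcal V$.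
   Context: Exact Courant algebroid: a vector bundle $E\to M$ with anchor $p:E\to TM$, a fibrewise nondegenerate symmetric bilinear form $\langle\cdot,\cdot\rangle$, and an $\mathbb R$-bilinear bracket $[\![\cdot,\cdot]\!]$ on $\Gamma(E)$ such that $[\![e_1,[\![e_2,e_3]\!]]\!]=[\![[\![e_1,e_2]\!],e_3]\!]+[\![e_2,[\![e_1,e_3]\!]]\!]$, $p[\![e_1,e_2]\!]=[p e_1,p e_2]$, $[\![e_1,fe_2]\!]=f[\![e_1,e_2]\!]+(\mathcal L_{p(e_1)}f)e_2$, $\mathcal L_{p(e_1)}\langle e_2,e_3\rangle=\langle[\![e_1,e_2]\!],e_3\rangle+\langle e_2,[\![e_1,e_3]\!]\rangle$, $[\![e,e]\!]=\frac12p^*d\langle e,e\rangle$, and $0\to T^*M\xrightarrow{p^*}E\xrightarrow{p}TM\to0$ is exact, where $\langle p^*\xi,e\rangle=\xi(p(e))$. An isotropic splitting is a bundle map $\nabla:TM\to E$ with $p\circ\nabla=\mathrm{id}$ and isotropic image. A Dirac structure is a Lagrangian subbundle $L\subset E$ ($L=L^\perp$) with $[\![\Gamma(L),\Gamma(L)]\!]\subset\Gamma(L)$. $\mathrm{Aut}(E)$ is the group of pairs $(\Psi,\psi)$, $\Psi:E\to E$ a bundle automorphism covering $\psi\in\mathrm{Diff}(M)$, preserving $\langle\cdot,\cdot\rangle$ and the bracket, with $p\circ\Psi=\psi_*\circ p$. Let $\psi_g$ be the diffeomorphism of $M$ given by $g\in G$. A $G$-lifted action is a pair $(\mathcal A,\chi)$,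 where $\mathcal A:G\to\mathrm{Aut}(E)$, $g\mapsto\mathcal A_g=(\Psi_g,\psi_g)$, is a homomorphism and $\chi:\mathfrak g\to\Gamma(E)$ is a bracket-preserving linear map such that the infinitesimal action of $u\in\mathfrak g$ on $\Gamma(E)$ induced by $\mathcal A$ equals $[\![\chi(u),\cdot]\!]$. It is isotropic if $\langle\chi(u),\chi(u)\rangle=0$ for all $u\in\mathfrak g$. A subbundle of $E$ or $E|_N$ is invariant if preserved by all $\Psi_g$. For $x\in N$, $K_x=\{\chi(u)(x)\,|\,u\in\mathfrak g\}+p^*(\mathrm{Ann}(T_xN))\subset E_x$; $K$ is an invariant isotropic subbundle of $E|_N$. Spinors: given an isotropic splitting $\nabla$, every $e\in E$ is uniquely $e=\nabla p(e)+p^*s_\nabla(e)$ with $s_\nabla(e)\in T^*M$. The Clifford algebra bundle $Cl(E)$ (relation $e_1e_2+e_2e_1=\langle e_1,e_2\rangle$) acts on $\wedge^\bullet T^*M$ by $\Pi_\nabla(e)\alpha=i_{p(e)}\alpha+s_\nabla(e)\wedge\alpha$ on generators $e\in E$. For a Lagrangian subbundle $L$ of $E$ (or of $E|_N$), $U_\nabla(L)=\{\varphi\in\wedge^\bullet T^*M\,|\,\Pi_\nabla(e)\varphi=0\ \forall e\in L\}$ (fibrewise, over $M$ or over $N$); it is a line bundle. Since $D$ is isotropic, the subalgebra of $Cl(E_x)$ generated by $D_x$ is isomorphic to $\wedge^\bullet D_x$, so $\det(D_x)$ (the top exterior power) is regarded as a subspace of $Cl(E_x)$ and $\Pi_\nabla(\mathfrak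 d)$ makes sense. *)

(* Defs.v *)
From HB Require Import structures.
From mathcomp Require Import all_boot all_order all_algebra.
From mathcomp Require Import all_classical all_reals all_analysis.

Set Implicit Arguments.
Unset Strict Implicit.
Unset Printing Implicit Defensive.
Import Order.TTheory GRing.Theory Num.Theory.
Import numFieldNormedType.Exports.
Local Open Scope classical_set_scope.
Local Open Scope ring_scope.

(** * Subspaces given by their elements *)

(* The subspace with underlying set P; only used for sets P that are linear
   subspaces, for which mem_vsub holds. *)
Definition vsub (R : fieldType) (V : vectType R) (P : set V) : {vspace V} :=
  xget 0%VS [set U : {vspace V} | forall v, v \in U <-> P v].

Lemma mem_vsub (R : fieldType) (V : vectType R) (P : set V) :
  P 0 -> (forall a u v, P u -> P v -> P (a *: u + v)) ->
  forall v, v \in vsub P <-> P v.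
Proof.
move=> P0 PD; rewrite /vsub; case: xgetP => [U _ //|noU]; exfalso.
pose Q k := `[< exists U : {vspace V}, (forall v, v \in U -> P v) /\ \dim U = k >].
have exQ : exists k, Q k.
  exists 0%N; apply/asboolP; exists 0%VS; split; last exact: dimv0.
  by move=> v; rewrite memv0 => /eqP->.
have ubQ k : Q k -> (k <= \dim {: V})%N.
  by move=> /asboolP[U [_ <-]]; apply: dimvS; exact: subvf.
case: (ex_maxnP exQ ubQ) => k /asboolP[U [UP dU]] kmax.
apply: (noU U) => v; split; first exact: UP.
move=> Pv; apply: contrapT => /negP vU.
suff /kmax : Q (\dim (<[v]> + U)) .
  rewrite -dU => le; move/negP: vU; apply.
  have : (U == <[v]> + U)%VS by rewrite eqEdim addvSr.
  by move/eqP=> ->; apply: (subvP (addvSl _ _)); exact: memv_line.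
apply/asboolP; exists (<[v]> + U)%VS; split=> // w /memv_addP[x].
move=> /vlineP[a ->] [y yU ->]; apply: PD => //; exact: UP.
Qed.

(** * Smooth manifolds *)

(* f is C^k on the open set U of R^n. *)
Fixpoint Ck (R : realType) (n k : nat) (U : set 'rV[R]_n) (f : 'rV[R]_n -> R)
    : Prop :=
  (forall x, U x -> {for x, continuous f}) /\
  (if k is k'.+1 then
     forall i : 'I_n, (forall x, U x -> derivable f x (delta_mx 0 i)) /\
       Ck k' U ('D_(delta_mx 0 i) f)
   else True).

Definition Cinf (R : realType) (n : nat) (U : set 'rV[R]_n)
  (f : 'rV[R]_n -> R) := forall k, Ck k U f.

(* ccoord and cinv are only meaningful on cdom and on its image. *)
Record chart (R : realType) (X : topologicalType) (n : nat) := Chart {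
  cdom : set X;
  ccoord : X -> 'rV[R]_n;
  cinv : 'rV[R]_n -> X }.

Section Charts.
Variables (R : realType) (X : topologicalType) (n : nat).
Implicit Types c : chart R X n.

Definition is_chart c :=
  [/\ open (cdom c), open (ccoord c @` cdom c),
      forall x, cdom c x -> cinv c (ccoord c x) = x,
      forall x, cdom c x -> {for x, continuous (ccoord c)} &
      forall v, (ccoord c @` cdom c) v -> {for v, continuous (cinv c)}].

Definition chart_compatible c c' := forall j : 'I_n,
  Cinf (ccoord c @` (cdom c `&` cdom c')) (fun v => ccoord c' (cinv c v) 0 j).
End Charts.

(* chart_at picks a preferred chart around each point, through which the
   tangent space at that point is identified with R^n. *)
Record charted (R : realType) (n : nat) := Charted {
  carrier :> topologicalType;
  atlas : set (chart R carrier n);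
  chart_at : carrier -> chart R carrier n }.
Arguments atlas {R n} c.

Definition is_manifold (R : realType) (n : nat) (X : charted R n) :=
  [/\ hausdorff_space X, @second_countable X,
      forall c, atlas X c -> is_chart c,
      forall c c' : chart R X n, atlas X c -> atlas X c' -> chart_compatible c c' &
      forall x : X, atlas X (chart_at x) /\ cdom (chart_at x) x].

Record manifold (R : realType) (n : nat) := Manifold {
  mcharted :> charted R n;
  manifoldP : is_manifold mcharted }.

Section ProductCharts.
Variables (R : realType) (n m : nat) (X : charted R n) (Y : charted R m).

Definition prod_chart (c : chart R X n) (c' : chart R Y m) :
    chart R (X * Y)%type (n + m) :=
  Chart (cdom c `*` cdom c') (fun q => row_mx (ccoord c q.1) (ccoord c' q.2))
    (fun v => (cinv c (lsubmx v), cinv c' (rsubmx v))).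

Definition prod_charted : charted R (n + m) :=
  @Charted R (n + m) (X * Y)%type
    [set prod_chart c c' | c in atlas X & c' in atlas Y]
    (fun q => prod_chart (chart_at q.1) (chart_at q.2)).
End ProductCharts.

Section SmoothFunctions.
Variables (R : realType) (n : nat) (X : charted R n).

(* W is meant to be open. *)
Definition smooth_fun (W : set X) (f : X -> R) := forall c, atlas X c ->
  Cinf (ccoord c @` (cdom c `&` W)) (f \o cinv c).

(* Smoothness on an arbitrary subset: local extendability to smooth functions.
   On an open subset of an embedded submanifold this is smoothness for the
   induced manifold structure. *)
Definition smooth_on (A : set X) (f : X -> R) := forall x, A x ->
  exists W F, [/\ open W, W x, smooth_fun W F &
                  forall y, W y -> A y -> F y = f y].

(* The derivative of f at x along the tangent vector v. *)
Definition dird (V : normedModType R) (f : X -> V) (x : X) (v : 'rV[R]_n) : V :=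
  'D_v (f \o cinv (chart_at x)) (ccoord (chart_at x) x).

(* The Lie bracket of vector fields, characterised by
   [Y, Z] f = Y (Z f) - Z (Y f) on the coordinate functions f at x. *)
Definition vf_bracket (Y Z : X -> 'rV[R]_n) (x : X) : 'rV[R]_n :=
  let field_coord (T : X -> 'rV[R]_n) y := dird (ccoord (chart_at x)) y (T y) in
  dird (field_coord Z) x (Y x) - dird (field_coord Y) x (Z x).

Definition differential (f : X -> R) (x : X) : 'Hom('rV[R]_n, R^o) :=
  linfun (dird (f : X -> R^o) x).
End SmoothFunctions.

Section SmoothMaps.
Variables (R : realType) (n m : nat) (X : charted R n) (Y : charted R m).

Definition smooth_map (F : X -> Y) := continuous F /\
  forall c' : chart R Y m, atlas Y c' -> forall j : 'I_m,
    smooth_fun (F @^-1` cdom c') (fun x => ccoord c' (F x) 0 j).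

Definition tangent_map (F : X -> Y) (x : X) (v : 'rV[R]_n) : 'rV[R]_m :=
  dird (ccoord (chart_at (F x)) \o F) x v.
End SmoothMaps.

Definition diffeo (R : realType) (n : nat) (X : charted R n) (F : X -> X) :=
  smooth_map F /\ exists F', [/\ smooth_map F', cancel F F' & cancel F' F].

(* Embedded submanifolds, of dimension d. *)
Section Submanifolds.
Variables (R : realType) (n : nat) (X : charted R n) (N : set X) (d : nat).

Definition slice_chart (c : chart R X n) :=
  [/\ is_chart c,
      forall c', atlas X c' -> chart_compatible c c' /\ chart_compatible c' c &
      forall x, cdom c x -> (N x <-> forall j : 'I_n, (d <= j)%N ->
                                       ccoord c x 0 j = 0)].

Definition submanifold := (d <= n)%N /\
  forall x, N x -> exists c, slice_chart c /\ cdom c x.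

Definition tangent_sub (x : X) : set 'rV[R]_n :=
  [set v | exists c, [/\ slice_chart c, cdom c x &
     forall j : 'I_n, (d <= j)%N -> dird (ccoord c) x v 0 j = 0]].
End Submanifolds.

(** * Vector bundles *)

Record triv (R : realType) (X : Type) (E : X -> vectType R) (m : nat) := Triv {
  tdom : set X;
  tcoord : forall x, 'Hom(E x, 'rV[R]_m) }.

(* A vector bundle is a family of vector spaces with local trivialisations;
   these determine the topology and smooth structure of the total space. *)
Record vbundle (R : realType) (n : nat) (X : charted R n) (m : nat) := VBundle {
  fib :> X -> vectType R;
  trivs : set (triv fib m) }.
Arguments trivs {R n X m} v.

Definition tframe (R : realType) (X : Type) (E : X -> vectType R) (m : nat)
    (t : triv E m) (i : 'I_m) (x : X) : E x :=
  ((tcoord t x)^-1)%VF (delta_mx 0 i).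

Definition lbij (R : fieldType) (U V : vectType R) (f : 'Hom(U, V)) :=
  lker f = 0%VS /\ limg f = fullv.

Section VectorBundles.
Variables (R : realType) (n : nat) (X : charted R n) (m : nat).
Variable E : vbundle X m.

Definition is_vbundle :=
  [/\ forall t : triv E m, trivs E t ->
        open (tdom t) /\ forall x, tdom t x -> lbij (tcoord t x),
      forall x : X, exists2 t : triv E m, trivs E t & tdom t x &
      forall t t' : triv E m, trivs E t -> trivs E t' -> forall i j : 'I_m,
        smooth_fun (tdom t `&` tdom t')
          (fun x => tcoord t' x (tframe t i x) 0 j)].

(* Smooth sections of E over a subset A of X. *)
Definition smooth_section (A : set X) (s : forall x, E x) :=
  forall t : triv E m, trivs E t -> forall j : 'I_m,
    smooth_on (A `&` tdom t) (fun x => tcoord t x (s x) 0 j).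

Definition Gamma (s : forall x, E x) := smooth_section setT s.

(* s is a smooth frame of F over the open subset A `&` W of A. *)
Definition local_frame (A W : set X) (F : forall x, {vspace E x}) (r : nat)
    (s : 'I_r -> forall x, E x) :=
  (forall i, smooth_section (A `&` W) (s i)) /\
  (forall y, A y -> W y -> basis_of (F y) [seq s i y | i <- enum 'I_r]).

(* F is a subbundle of the restriction of E to A. *)
Definition subbundle (A : set X) (F : forall x, {vspace E x}) :=
  exists r : nat, forall x, A x -> exists W (s : 'I_r -> forall y, E y),
    [/\ open W, W x & local_frame A W F s].
End VectorBundles.

Definition tangent_bundle (R : realType) (n : nat) (X : charted R n) :
    vbundle X n :=
  @VBundle R n X n (fun _ => 'rV[R]_n)
    [set Triv (E := fun _ => 'rV[R]_n) (cdom c)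
           (fun x => linfun (dird (ccoord c) x)) | c in atlas X].

(* Fibrewise linear maps E -> F covering psi. *)
Definition smooth_morphism (R : realType) (n n' m m' : nat)
    (X : charted R n) (Y : charted R n') (E : vbundle X m) (F : vbundle Y m')
    (psi : X -> Y) (Psi : forall x, 'Hom(E x, F (psi x))) :=
  forall (t : triv E m) (t' : triv F m'), trivs E t -> trivs F t' ->
  forall i j, smooth_fun (tdom t `&` psi @^-1` tdom t')
    (fun x => tcoord t' (psi x) (Psi x (tframe t i x)) 0 j).

(* e' is the push-forward of the section e by (Psi, psi). *)
Definition pushes (X Y : Type) (R : realType) (E : X -> vectType R)
    (F : Y -> vectType R) (psi : X -> Y) (Psi : forall x, 'Hom(E x, F (psi x)))
    (e : forall x, E x) (e' : forall y, F y) :=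
  forall x, e' (psi x) = Psi x (e x).

(** * Exact Courant algebroids *)

Section Forms.
Variables (R : realType) (V : vectType R) (B : V -> V -> R).

Definition nondeg_sym :=
  [/\ forall a u v w, B (a *: u + v) w = a * B u w + B v w,
      forall u v, B u v = B v u &
      forall v, (forall w, B v w = 0) -> v = 0].

Definition orth (U : {vspace V}) : {vspace V} :=
  vsub [set v | forall w, w \in U -> B v w = 0].

Definition isotropic (U : {vspace V}) :=
  forall v w, v \in U -> w \in U -> B v w = 0.

(* The vector p^* xi, defined by <p^* xi, e> = xi (p e). *)
Definition costar (T : vectType R) (p : 'Hom(V, T)) (xi : 'Hom(T, R^o)) : V :=
  xget 0 [set v | forall e, B v e = xi (p e)].
End Forms.

Record exactCourant (R : realType) (n : nat) (M : manifold R n) (m : nat) :=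
ExactCourant {
  cbundle :> vbundle M m;
  cform : forall x, cbundle x -> cbundle x -> R;
  anchor : forall x, 'Hom(cbundle x, 'rV[R]_n);
  cbracket : (forall x, cbundle x) -> (forall x, cbundle x) ->
             (forall x, cbundle x);
  pstar := fun x => costar (@cform x) (anchor x);
  courant_bundle : is_vbundle cbundle;
  courant_form : forall x, nondeg_sym (@cform x);
  courant_form_smooth : forall t : triv cbundle m, trivs cbundle t -> forall i j,
    smooth_fun (tdom t) (fun x => cform (tframe t i x) (tframe t j x));
  courant_anchor_smooth : smooth_morphism (F := tangent_bundle M) (psi := id) anchor;
  cbracket_section : forall e1 e2, Gamma e1 -> Gamma e2 ->
    Gamma (cbracket e1 e2);
  cbracket_linearl : forall (a : R) e1 e2 e3,
    Gamma e1 -> Gamma e2 -> Gamma e3 -> forall x,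
    cbracket (fun y => a *: e1 y + e2 y) e3 x =
      a *: cbracket e1 e3 x + cbracket e2 e3 x;
  cbracket_linearr : forall (a : R) e1 e2 e3,
    Gamma e1 -> Gamma e2 -> Gamma e3 -> forall x,
    cbracket e1 (fun y => a *: e2 y + e3 y) x =
      a *: cbracket e1 e2 x + cbracket e1 e3 x;
  courant_jacobi : forall e1 e2 e3, Gamma e1 -> Gamma e2 -> Gamma e3 ->
    forall x, cbracket e1 (cbracket e2 e3) x =
      cbracket (cbracket e1 e2) e3 x + cbracket e2 (cbracket e1 e3) x;
  courant_anchor_bracket : forall e1 e2, Gamma e1 -> Gamma e2 -> forall x,
    anchor x (cbracket e1 e2 x) =
      vf_bracket (fun y => anchor y (e1 y)) (fun y => anchor y (e2 y)) x;
  courant_leibniz : forall (f : M -> R) e1 e2,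
    smooth_fun setT f -> Gamma e1 -> Gamma e2 -> forall x,
    cbracket e1 (fun y => f y *: e2 y) x =
      f x *: cbracket e1 e2 x + dird f x (anchor x (e1 x)) *: e2 x;
  courant_invariance : forall e1 e2 e3, Gamma e1 -> Gamma e2 -> Gamma e3 ->
    forall x, dird (fun y => cform (e2 y) (e3 y)) x (anchor x (e1 x)) =
      cform (cbracket e1 e2 x) (e3 x) + cform (e2 x) (cbracket e1 e3 x);
  courant_square : forall e, Gamma e -> forall x,
    cbracket e e x =
      2^-1 *: pstar x (differential (fun y => cform (e y) (e y)) x);
  courant_exact_l : forall x, injective (pstar x);
  courant_exact_m : forall x v,
    anchor x v = 0 <-> exists xi, v = pstar x xi;
  courant_exact_r : forall x w, exists v, anchor x v = w }.

Section Courant.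
Variables (R : realType) (n m : nat) (M : manifold R n).
Variable E : exactCourant M m.

Definition perp (F : forall x, {vspace E x}) (x : M) : {vspace E x} :=
  orth (@cform _ _ _ _ E x) (F x).

Definition isotropic_on (A : set M) (F : forall x, {vspace E x}) :=
  forall x, A x -> isotropic (@cform _ _ _ _ E x) (F x).

(* Lagrangian subbundles of the restriction of E to A. *)
Definition lagrangian_on (A : set M) (F : forall x, {vspace E x}) :=
  subbundle A F /\ forall x, A x -> F x = perp F x.

Definition dirac_structure (L : forall x, {vspace E x}) :=
  lagrangian_on setT L /\
  forall e1 e2, Gamma e1 -> Gamma e2 ->
    (forall x, e1 x \in L x) -> (forall x, e2 x \in L x) ->
    forall x, cbracket e1 e2 x \in L x.

Definition isotropic_splitting (nab : forall x, 'Hom('rV[R]_n, E x)) :=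
  [/\ smooth_morphism (E := tangent_bundle M) (F := E) (psi := id) nab,
      forall x v, anchor E x (nab x v) = v &
      forall x v w, cform (nab x v) (nab x w) = 0].

Definition is_aut (psi : M -> M) (Psi : forall x, 'Hom(E x, E (psi x))) :=
  [/\ diffeo psi,
      (forall x, lbij (Psi x)) /\ smooth_morphism Psi,
      forall x v w, cform (Psi x v) (Psi x w) = cform v w,
      forall e1 e2 e1' e2', Gamma e1 -> Gamma e2 -> Gamma e1' -> Gamma e2' ->
        pushes Psi e1 e1' -> pushes Psi e2 e2' ->
        pushes Psi (cbracket e1 e2) (cbracket e1' e2') &
      forall x v, anchor E (psi x) (Psi x v) = tangent_map psi x (anchor E x v)].
End Courant.

(** * Lie groups and lifted actions *)

Record lieGroup (R : realType) (k : nat) := LieGroup {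
  gmanifold :> manifold R k;
  gmul : gmanifold -> gmanifold -> gmanifold;
  gone : gmanifold;
  ginv : gmanifold -> gmanifold;
  gmulA : associative gmul;
  gmul1 : left_id gone gmul;
  gmulV : left_inverse gone ginv gmul;
  gmul_smooth : smooth_map (X := prod_charted gmanifold gmanifold)
                  (fun q => gmul q.1 q.2);
  ginv_smooth : smooth_map ginv }.

(* The Lie algebra is T_1 G = R^k, with the bracket of left-invariant vector
   fields. *)
Section LieAlgebra.
Variables (R : realType) (k : nat) (G : lieGroup R k).

Definition left_invariant (u : 'rV[R]_k) (g : G) : 'rV[R]_k :=
  tangent_map (gmul g) (gone G) u.

Definition lie_bracket (u v : 'rV[R]_k) : 'rV[R]_k :=
  vf_bracket (left_invariant u) (left_invariant v) (gone G).
End LieAlgebra.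

Definition total_map (X : Type) (R : realType) (E : X -> vectType R)
    (psi : X -> X) (Psi : forall x, 'Hom(E x, E (psi x))) (z : {x : X & E x}) :
    {x : X & E x} :=
  existT E (psi (projT1 z)) (Psi (projT1 z) (projT2 z)).

(* In lact_infinitesimal, g |-> eg g is the action (g . e) = Psi_g o e o
   psi_g^-1 of G on the section e, and the derivative of g |-> eg g x in the
   fibre E x, at the identity in the direction u, is read off through linear
   functionals.  With this action on sections, u |-> p (chi u) is a
   homomorphism for the bracket of left-invariant fields. *)
Record liftedAction (R : realType) (n m k : nat) (M : manifold R n)
    (E : exactCourant M m) (G : lieGroup R k) := LiftedAction {
  act : G -> M -> M;
  Act : forall g x, 'Hom(E x, E (act g x));
  chi : 'rV[R]_k -> forall x, E x;
  lact_aut : forall g, is_aut (Act g);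
  lact_one : total_map (Act (gone G)) =1 id;
  lact_mul : forall g h, total_map (Act (gmul g h)) =1
                         total_map (Act g) \o total_map (Act h);
  lact_smooth : smooth_map (X := prod_charted G M) (fun q => act q.1 q.2);
  lact_smooth_bundle : forall t t' : triv E m, trivs E t -> trivs E t' ->
    forall i j, smooth_fun (X := prod_charted G M)
      [set q | tdom t q.2 /\ tdom t' (act q.1 q.2)]
      (fun q => tcoord t' (act q.1 q.2) (Act q.1 q.2 (tframe t i q.2)) 0 j);
  chi_section : forall u, Gamma (chi u);
  chi_linear : forall (a : R) u v x,
    chi (a *: u + v) x = a *: chi u x + chi v x;
  chi_bracket : forall u v x,
    chi (lie_bracket G u v) x = cbracket (chi u) (chi v) x;
  lact_infinitesimal : forall u (e : forall x, E x) (eg : G -> forall x, E x),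
    Gamma e -> (forall g, pushes (Act g) e (eg g)) ->
    forall x (l : 'Hom(E x, R^o)),
      dird (fun g => l (eg g x)) (gone G) u = l (cbracket (chi u) e x) }.

Section LiftedActions.
Variables (R : realType) (n m k : nat) (M : manifold R n).
Variables (E : exactCourant M m) (G : lieGroup R k) (A : liftedAction E G).

Definition isotropic_action := forall u x, cform (chi A u x) (chi A u x) = 0.

Definition invariant_set (N : set M) := forall g x, N x -> N (act A g x).

Definition free_on (N : set M) :=
  forall g x, N x -> act A g x = x -> g = gone G.

Definition invariant_on (N : set M) (F : forall x, {vspace E x}) :=
  forall g x, N x -> (Act A g x @: F x)%VS = F (act A g x).

(* K_x = { chi(u)(x) } + p^* Ann(T_x N) *)
Definition Kbundle (N : set M) (d : nat) (x : M) : {vspace E x} :=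
  vsub [set v | exists u (xi : 'Hom('rV[R]_n, R^o)),
    (forall w, tangent_sub N d x w -> xi w = 0) /\
    v = chi A u x + pstar E x xi].

Definition constant_rank (N : set M) (F : forall x, {vspace E x}) :=
  exists r : nat, forall x, N x -> \dim (F x) = r.

Definition perturbation_input (N : set M) (L K D : forall x, {vspace E x}) :=
  [/\ subbundle N D, invariant_on N D, isotropic_on N D &
      forall x, N x ->
        (perp (fun y => L y :&: K y) x + D x = fullv /\
         perp (fun y => L y :&: K y) x :&: D x = 0)%VS].
End LiftedActions.

(** * Exterior forms and Clifford algebras *)

(* Elements of the exterior algebra of T^*: a k-linear alternating map for each
   k, automatically zero for k > dim T (see alternating below). *)
Definition xform (R : realType) (T : vectType R) :=
  forall k : nat, ('I_k -> T) -> R.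

Section ExteriorForms.
Variables (R : realType) (T : vectType R).

Definition upd (k : nat) (v : 'I_k -> T) (i : 'I_k) (x : T) : 'I_k -> T :=
  fun j => if j == i then x else v j.

Definition alternating (al : xform T) := forall k,
  (forall (v : 'I_k -> T) i a x y,
     al k (upd v i (a *: x + y)) = a * al k (upd v i x) + al k (upd v i y)) /\
  (forall (v : 'I_k -> T) i j, i != j -> v i = v j -> al k v = 0).

Definition xzero : xform T := fun _ _ => 0.
Definition xadd (al be : xform T) : xform T := fun k v => al k v + be k v.
Definition xscale (a : R) (al : xform T) : xform T := fun k v => a * al k v.

Definition vcons (k : nat) (x : T) (v : 'I_k -> T) : 'I_k.+1 -> T :=
  fun i => if unlift ord0 i is Some j then v j else x.

Definition interior (x : T) (al : xform T) : xform T :=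
  fun k v => al k.+1 (vcons x v).

Definition wedge1 (s : 'Hom(T, R^o)) (al : xform T) : xform T :=
  fun k => match k with
  | 0%N => fun _ => 0
  | k'.+1 => fun v =>
      \sum_(i < k'.+1) (-1) ^+ i * s (v i) * al k' (fun j => v (lift i j))
  end.
End ExteriorForms.

Section Clifford.
Variables (R : realType) (V : vectType R) (B : V -> V -> R).

(* The Clifford algebra of (V, B), with relation uv + vu = B u v, is the
   quotient of clexpr by the congruence cleq. *)
Inductive clexpr :=
| ClScal of R
| ClGen of V
| ClAdd of clexpr & clexpr
| ClMul of clexpr & clexpr.

Inductive cleq : clexpr -> clexpr -> Prop :=
| cleq_refl s : cleq s s
| cleq_sym s t : cleq s t -> cleq t s
| cleq_trans s t u : cleq s t -> cleq t u -> cleq s u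
| cleq_add s s' t t' : cleq s s' -> cleq t t' -> cleq (ClAdd s t) (ClAdd s' t')
| cleq_mul s s' t t' : cleq s s' -> cleq t t' -> cleq (ClMul s t) (ClMul s' t')
| cleq_addA s t u : cleq (ClAdd s (ClAdd t u)) (ClAdd (ClAdd s t) u)
| cleq_addC s t : cleq (ClAdd s t) (ClAdd t s)
| cleq_add0 s : cleq (ClAdd (ClScal 0) s) s
| cleq_mulA s t u : cleq (ClMul s (ClMul t u)) (ClMul (ClMul s t) u)
| cleq_mul1 s : cleq (ClMul (ClScal 1) s) s
| cleq_mul0 s : cleq (ClMul (ClScal 0) s) (ClScal 0)
| cleq_mulDl s t u :
    cleq (ClMul (ClAdd s t) u) (ClAdd (ClMul s u) (ClMul t u))
| cleq_mulDr s t u :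
    cleq (ClMul s (ClAdd t u)) (ClAdd (ClMul s t) (ClMul s u))
| cleq_scalD a b : cleq (ClScal (a + b)) (ClAdd (ClScal a) (ClScal b))
| cleq_scalM a b : cleq (ClScal (a * b)) (ClMul (ClScal a) (ClScal b))
| cleq_scalC a s : cleq (ClMul (ClScal a) s) (ClMul s (ClScal a))
| cleq_gen a u v :
    cleq (ClGen (a *: u + v)) (ClAdd (ClMul (ClScal a) (ClGen u)) (ClGen v))
| cleq_clifford u v :
    cleq (ClAdd (ClMul (ClGen u) (ClGen v)) (ClMul (ClGen v) (ClGen u)))
         (ClScal (B u v)).

Definition clprod (s : seq V) : clexpr :=
  foldr (fun v => ClMul (ClGen v)) (ClScal 1) s.

(* For U isotropic, the line det(U) in the Clifford algebra: the multiples of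
   products of bases of U. *)
Definition in_det (U : {vspace V}) (t : clexpr) :=
  exists (a : R) (b : seq V),
    basis_of U b /\ cleq t (ClMul (ClScal a) (clprod b)).

Fixpoint claction (T : vectType R) (Pi : V -> xform T -> xform T) (t : clexpr)
    (al : xform T) : xform T :=
  match t with
  | ClScal a => xscale a al
  | ClGen v => Pi v al
  | ClAdd t1 t2 => xadd (claction Pi t1 al) (claction Pi t2 al)
  | ClMul t1 t2 => claction Pi t1 (claction Pi t2 al)
  end.
End Clifford.

(** * Spinors *)

Section Spinors.
Variables (R : realType) (n m : nat) (M : manifold R n).
Variables (E : exactCourant M m) (nab : forall x, 'Hom('rV[R]_n, E x)).

(* s_nab e is the covector with e = nab (p e) + p^* (s_nab e). *)
Definition snab (x : M) (e : E x) : 'Hom('rV[R]_n, R^o) :=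
  xget 0 [set s | e = nab x (anchor E x e) + pstar E x s].

Definition Pinab (x : M) (e : E x) (al : xform 'rV[R]_n) : xform 'rV[R]_n :=
  xadd (interior (anchor E x e) al) (wedge1 (snab e) al).

Definition in_U (x : M) (L : {vspace E x}) (al : xform 'rV[R]_n) :=
  alternating al /\ forall e, e \in L -> Pinab e al = @xzero R 'rV[R]_n.

(* Smoothness over A of a section of the exterior bundle of T^*M: its
   components in the coordinate frames are smooth. *)
Definition smooth_forms (A : set M) (phi : M -> xform 'rV[R]_n) :=
  forall t : triv (tangent_bundle M) n,
    trivs (tangent_bundle M) t ->
  forall k (ix : 'I_k -> 'I_n),
    smooth_on (A `&` tdom t) (fun x => phi x k (fun a => tframe t (ix a) x)).

(* Nowhere-zero smooth sections over A of the line bundle U_nab(L). *)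
Definition nz_section_U (A : set M) (L : forall x, {vspace E x})
    (phi : M -> xform 'rV[R]_n) :=
  smooth_forms A phi /\
  forall x, A x -> in_U (L x) (phi x) /\ phi x <> @xzero R 'rV[R]_n.

(* Nowhere-zero smooth sections over A of det(D), as a line subbundle of
   Cl(E): locally smooth multiples of products of smooth frames of D. *)
Definition nz_section_det (A : set M) (D : forall x, {vspace E x})
    (dd : forall x, clexpr (E x)) :=
  (forall x, A x ->
     in_det (@cform _ _ _ _ E x) (D x) (dd x) /\
     ~ cleq (@cform _ _ _ _ E x) (dd x) (ClScal _ 0)) /\
  (forall x, A x -> exists W r (s : 'I_r -> forall y, E y) (f : M -> R),
     [/\ open W, W x, local_frame A W D s, smooth_on (A `&` W) f &
         forall y, A y -> W y ->
           cleq (@cform _ _ _ _ E y) (dd y)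
             (ClMul (ClScal _ (f y)) (clprod [seq s i y | i <- enum 'I_r]))]).
End Spinors.

(* Main.v *)
From HB Require Import structures.
From mathcomp Require Import all_boot all_order all_algebra.
From mathcomp Require Import all_classical all_reals all_analysis.
From mathcomp Require Import ring lra zify.
Require Import Defs.

Set Implicit Arguments.
Unset Strict Implicit.
Unset Printing Implicit Defensive.
Import Order.TTheory GRing.Theory Num.Theory.
Import numFieldNormedType.Exports.
Local Open Scope classical_set_scope.
Local Open Scope ring_scope.

(** Everything except smoothness is linear algebra in the fibres: since L is
    contained in the orthogonal of L|_N cap K, it meets D trivially, and each
    claim on L_D follows by pairing vectors with L|_N cap K.  This uses that K
    is isotropic, hence that p(chi(u)) is tangent to N: for a smooth function f
    vanishing on the invariant set N, the section f chi(u) has all its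
    translates zero on N, so [[chi(u), f chi(u)]] vanishes there, and by the
    Leibniz rule f has zero derivative along p(chi(u)); f ranges over the
    defining coordinates of N, cut off by bump functions.  For the spinors, an
    element of L cap D^perp anticommutes with D and kills phi, an element of D
    squares to zero, and Pi(d_1 ... d_r) phi is nonzero because D has a dual
    family in L: applying its members one after the other gives phi back. *)

(** * Functions of class C^k *)

(** The Leibniz rule is available only for functions smooth on all of M, while the equations of N
    are coordinates of a single chart; and [dird] differentiates in arbitrary directions, whereas
    [Ck] speaks of coordinate partials only. Hence the need for bump functions with closed support
    in a chart domain, and for the theorem that C^1 functions are differentiable. Fibrewise linear
    algebra does not make L_D a subbundle, since the rank of an intersection may jump. Here L cap
    D^perp is the kernel of the pairing of L with D, and L cap D = 0 with L Lagrangian makes its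
    matrix of full column rank at every point of N; the total rank then follows because L_D and L
    are both Lagrangian. Forms are families of alternating maps. Their identities are proved by
    contracting the first argument, an induction on the degree that avoids sums over permutations.
    Contractions anticommute only on alternating maps, so alternation is carried along wherever the
    Clifford relation is used. *)

Section Directional.
Variables (R : realType) (V : normedModType R).
Implicit Types (f : V -> R) (x v : V).

Lemma is_derive_line f x v r : derivable f (x + r *: v) v ->
  is_derive r 1 (fun t : R => f (x + t *: v)) ('D_v f (x + r *: v)).
Proof.
have quotE : (fun t : R => t^-1 *: ((f \o shift (x + r *: v)) (t *: v) -
                                    f (x + r *: v))) =
    fun t => t^-1 *: (((fun t : R => f (x + t *: v)) \o shift r) (t *: 1) -
                     f (x + r *: v)).
  by apply/funext => t /=; rewrite [_ *: 1]mulr1 scalerDl addrCA.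
by rewrite /derivable /derive quotE.
Qed.

(** The one-variable chain rule, applied to the restriction of f to the line x + t v at t = 0;
    derivability in the single direction v suffices. *)
Lemma is_derive_comp1 (h : R -> R) f x v (h' : R) :
  derivable f x v -> is_derive (f x) 1 h h' ->
  is_derive x v (h \o f) (h' * 'D_v f x).
Proof.
move=> df dh.
have quotE (g : V -> R) : (fun t : R => t^-1 *: ((g \o shift x) (t *: v) - g x)) =
    fun t => t^-1 *: (((fun t : R => g (x + t *: v)) \o shift 0) (t *: 1) -
                     g (x + 0 *: v)).
  by apply/funext => t /=; rewrite [_ *: 1]mulr1 scale0r !addr0 (addrC x).
have x0 : x + 0 *: v = x by rewrite scale0r addr0.
rewrite -{1}x0 in df; rewrite -{1}x0 in dh.
have := is_derive1_comp dh (is_derive_line df).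
case=> dhf ehf; rewrite -{2}x0; split.
  by rewrite /derivable quotE; exact: dhf.
by rewrite -ehf /derive quotE.
Qed.
End Directional.

Section CkCalculus.
Variables (R : realType) (n : nat).
Implicit Types (U V : set 'rV[R]_n) (f g : 'rV[R]_n -> R).

Lemma Ck_continuous k U f x : Ck k U f -> U x -> {for x, continuous f}.
Proof. by case: k => [|k] [cf _]; exact: cf. Qed.

Lemma Ck_subset k U V f : U `<=` V -> Ck k V f -> Ck k U f.
Proof.
move=> UV; elim: k f => [|k IH] f [cf df]; first by split=> // x /UV/cf.
split=> [x /UV/cf //|i].
have [dfi Dfi] := df i; split=> [x /UV/dfi //|]; exact: IH.
Qed.

Lemma Ck_local k U f : (forall x, U x -> exists2 V, V x & Ck k V f) -> Ck k U f.
Proof.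
elim: k f => [|k IH] f locf.
  by split=> // x /locf[V Vx [cf _]]; exact: cf.
split=> [x /locf[V Vx [cf _]]|i]; first exact: cf.
split=> [x /locf[V Vx [_ /(_ i)[df _]]]|]; first exact: df.
by apply: IH => x /locf[V Vx [_ /(_ i)[_ Df]]]; exists V.
Qed.

Lemma CkW k U f : Ck k.+1 U f -> Ck k U f.
Proof.
elim: k f => [|k IH] f [cf df]; split=> // i.
by have [dfi Dfi] := df i; split=> //; exact: IH.
Qed.

Lemma continuous_eq_on_open U f g x : open U -> (forall y, U y -> f y = g y) ->
  U x -> {for x, continuous f} -> {for x, continuous g}.
Proof.
move=> oU fg Ux; rewrite /prop_for /continuous_at -fg //; apply: cvg_trans.
apply: (near_eq_cvg (F := nbhs x)).
by apply: filterS (open_nbhs_nbhs (conj oU Ux)).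
Qed.

Lemma eq_Ck k U f g : open U -> (forall x, U x -> f x = g x) ->
  Ck k U f -> Ck k U g.
Proof.
move=> oU; elim: k f g => [|k IH] f g fg [cf df].
  by split=> // x Ux; exact: continuous_eq_on_open oU fg Ux (cf x Ux).
split=> [x Ux|i]; first exact: continuous_eq_on_open oU fg Ux (cf x Ux).
have fgn x : U x -> \near x, f x = g x.
  by move=> Ux; apply: filterS (open_nbhs_nbhs (conj oU Ux)); exact: fg.
have [dfi Dfi] := df i; split=> [x Ux|].
  exact: near_eq_derivable (fgn _ Ux) (dfi x Ux).
by apply: IH Dfi => x Ux; apply: near_eq_derive; exact: fgn.
Qed.

Lemma Ck_cst k U (a : R) : Ck k U (fun=> a).
Proof.
elim: k a => [|k IH] a; first by split=> // x _; exact: cst_continuous.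
split=> [x _|i]; first exact: cst_continuous.
split=> [x _|]; first exact: derivable_cst.
rewrite (_ : 'D__ _ = (fun=> 0)) //.
by apply/funext => x; exact: derive_cst.
Qed.

Lemma CkD k U f g : open U -> Ck k U f -> Ck k U g -> Ck k U (fun x => f x + g x).
Proof.
move=> oU; elim: k f g => [|k IH] f g [cf df] [cg dg].
  by split=> // x Ux; apply: continuousD; [exact: cf | exact: cg].
split=> [x Ux|i]; first by apply: continuousD; [exact: cf | exact: cg].
have [dfi Dfi] := df i; have [dgi Dgi] := dg i.
split=> [x Ux|]; first by apply: derivableD; [exact: dfi | exact: dgi].
apply: eq_Ck (IH _ _ Dfi Dgi) => // x Ux.
by rewrite -deriveD //; [exact: dfi | exact: dgi].
Qed.

Lemma CkM k U f g : open U -> Ck k U f -> Ck k U g -> Ck k U (fun x => f x * g x).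
Proof.
move=> oU; elim: k f g => [|k IH] f g Cf Cg; have [cf df] := Cf; have [cg dg] := Cg.
  by split=> // x Ux; apply: continuousM; [exact: cf | exact: cg].
split=> [x Ux|i]; first by apply: continuousM; [exact: cf | exact: cg].
have [dfi Dfi] := df i; have [dgi Dgi] := dg i.
split=> [x Ux|]; first by apply: derivableM; [exact: dfi | exact: dgi].
have := CkD oU (IH _ _ (CkW Cf) Dgi) (IH _ _ (CkW Cg) Dfi).
apply: eq_Ck => // x Ux.
by rewrite -[RHS]/('D__ (f * g) x) deriveM //; [exact: dfi | exact: dgi].
Qed.

(** The family h is closed under differentiation up to linear combinations, recorded by [succ]. A
    partial derivative of [h j \o f] is then a combination of members of the family at f, times a
    partial of f, so the induction on k runs over all j at once. *)
Lemma Ck_comp1 (J : Type) (h : J -> R -> R) (succ : J -> seq (R * J)) (S : set R)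
    k j U f :
  open U ->
  (forall j s, S s -> is_derive s 1 (h j) (\sum_(p <- succ j) p.1 * h p.2 s)) ->
  (forall x, U x -> S (f x)) -> Ck k U f -> Ck k U (h j \o f).
Proof.
move=> oU dh fS; elim: k j => [|k IH] j Cf; have [cf df] := Cf.
  split=> // x Ux; apply: continuous_comp; first exact: cf.
  by apply/differentiable_continuous/derivable1_diffP; case: (dh j _ (fS _ Ux)).
split=> [x Ux|i].
  apply: continuous_comp; first exact: cf.
  by apply/differentiable_continuous/derivable1_diffP; case: (dh j _ (fS _ Ux)).
have [dfi Dfi] := df i.
have chain x (Ux : U x) := is_derive_comp1 (dfi x Ux) (dh j _ (fS x Ux)).
split=> [x Ux|]; first by case: (chain x Ux).
have : Ck k U (fun x => (\sum_(p <- succ j) p.1 * h p.2 (f x)) *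
                        'D_(delta_mx 0 i) f x).
  apply: CkM => //; elim: (succ j) => [|p s IHs].
    by apply: eq_Ck (Ck_cst k U 0) => // x _; rewrite big_nil.
  apply: eq_Ck (CkD oU (CkM oU (Ck_cst k U p.1) (IH p.2 (CkW Cf))) IHs) => // x _.
  by rewrite big_cons.
by apply: eq_Ck => // x Ux; case: (chain x Ux).
Qed.

Lemma CkN k U f : open U -> Ck k U f -> Ck k U (fun x => - f x).
Proof.
move=> oU Cf; apply: eq_Ck (CkM oU (Ck_cst k U (- 1)) Cf) => // x _.
by rewrite mulN1r.
Qed.

Lemma CkV k U f : open U -> (forall x, U x -> f x != 0) -> Ck k U f ->
  Ck k U (fun x => (f x)^-1).
Proof.
move=> oU f0; elim: k => [|k IH] Cf; have [cf df] := Cf.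
  by split=> // x Ux; apply: continuousV; [exact: f0 | exact: cf].
split=> [x Ux|i]; first by apply: continuousV; [exact: f0 | exact: cf].
have [dfi Dfi] := df i; have Vf := IH (CkW Cf).
split=> [x Ux|]; first by apply: derivableV; [exact: f0 | exact: dfi].
apply: eq_Ck (CkN oU (CkM oU (CkM oU Vf Vf) Dfi)) => // x Ux.
rewrite deriveV; [| exact: f0 | exact: dfi].
by rewrite -invfM -expr2 scaleNr.
Qed.
End CkCalculus.

(** * Differentiability of C^1 functions *)

Section C1Differentiable.
Variables (R : realType) (n : nat).
Implicit Types (U : set 'rV[R]_n) (f : 'rV[R]_n -> R).

Lemma normr_entry_le (h : 'rV[R]_n) i : `|h 0 i| <= `|h|.
Proof.
rewrite [leRHS]/Num.norm/= mx_normrE.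
exact: (le_bigmax_cond _ (fun ij : 'I_1 * 'I_n => `|h ij.1 ij.2|) (j := (0, i))).
Qed.

Definition row_form (c : 'I_n -> R) (h : 'rV[R]_n) : R := \sum_i h 0 i * c i.

Lemma row_form_is_linear c : linear (row_form c : 'rV[R]_n -> R^o).
Proof.
move=> a u v; rewrite /row_form scaler_sumr -big_split; apply: eq_bigr => i _ /=.
by rewrite !mxE mulrDl -mulrA.
Qed.
HB.instance Definition _ c :=
  GRing.isLinear.Build R 'rV[R]_n R^o *:%R (row_form c) (row_form_is_linear c).

Lemma row_form_continuous c : continuous (row_form c).
Proof.
rewrite /row_form; apply: continuous_big => [|i _]; first exact: add_continuous.
by move=> x; apply: continuousM; [exact: coord_continuous | exact: cst_continuous].
Qed.

(** The segment is parametrised by s in [0, 1] rather than by its length, so that the sign of t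
    needs no case distinction. *)
Lemma mvt_line f (y : 'rV[R]_n) (i : 'I_n) (t : R) :
  (forall s : R, 0 <= s <= 1 ->
     derivable f (y + (s * t) *: delta_mx 0 i) (delta_mx 0 i)) ->
  exists2 s : R, 0 <= s <= 1 & f (y + t *: delta_mx 0 i) - f y =
    t * 'D_(delta_mx 0 i) f (y + (s * t) *: delta_mx 0 i).
Proof.
set e := delta_mx 0 i => df.
pose g s := f (y + (s * t) *: e).
have dg (s : R) : 0 <= s <= 1 -> is_derive s 1 g (t * 'D_e f (y + (s * t) *: e)).
  move=> s01; rewrite mulrC.
  have dl : is_derive s 1 (fun r : R => r * t) t.
    have := @is_deriveM _ _ (id : R -> R) (cst t) s 1 1 0.
    move=> /(_ (is_derive_id _ _) (is_derive_cst _ _ _)) H.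
    by apply: is_derive_eq H _; rewrite scaler0 add0r [_ *: 1]mulr1.
  exact: (@is_derive1_comp R (fun r => f (y + r *: e)) (fun r => r * t) s _ _
    (is_derive_line (df s s01)) dl).
have := @MVT_segment R g (fun s => t * 'D_e f (y + (s * t) *: e)) 0 1 ler01.
have ge0 (s : R) : s \in `]0, 1[%R -> 0 <= s <= 1.
  by rewrite in_itv /= => /andP[/ltW -> /ltW ->].
case=> [s /ge0/dg //||s].
  apply: continuous_in_subspaceT => s; rewrite inE /= in_itv /= => /dg[ds _].
  exact/differentiable_continuous/derivable1_diffP.
rewrite in_itv /= /g mul1r mul0r scale0r addr0 subr0 mulr1 => s01 ->.
by exists s.
Qed.

(** The increment of f is telescoped along the truncations [P m h], which keep the first m
    coordinates of h. By the mean value theorem each step is a coordinate of h times a partial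
    derivative at a point near x, where it is close to its value [c i] at x. *)
Lemma C1_differentiable U f x : open U -> Ck 1 U f -> U x -> differentiable f x.
Proof.
move=> oU [cf df] Ux.
pose c i := 'D_(delta_mx 0 i) f x.
pose P m (h : 'rV[R]_n) : 'rV[R]_n := \row_(i < n) (if (i < m)%N then h 0 i else 0).
have Pm1 m (mn : (m < n)%N) h :
    P m.+1 h = P m h + h 0 (Ordinal mn) *: delta_mx 0 (Ordinal mn).
  apply/rowP => i; rewrite !mxE /= ltnS leq_eqVlt -(inj_eq val_inj) /=.
  have [im|im] /= := eqVneq (i : nat) m.
    by rewrite im ltnn add0r mulr1; congr (h _ _); exact: val_inj.
  by rewrite mulr0 addr0.
(* In the max norm, a truncation of h moved part of the way along a later coordinate is no longer
   than h, so the mean value points stay in the chosen ball. *)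
have Pball m h (s : R) (i : 'I_n) : 0 <= s <= 1 -> (i >= m)%N ->
    `|P m h + (s * h 0 i) *: delta_mx 0 i| <= `|h|.
  move=> /andP[s0 s1] im; rewrite [leLHS]/Num.norm/= mx_normrE.
  apply/bigmax_leP; split=> // -[j l] _ /=; rewrite (ord1 j) !mxE eqxx /=.
  apply: le_trans (normr_entry_le h l); case: ltnP => lm.
    have /negbTE -> : l != i by apply: contraTneq lm => ->; rewrite -leqNgt.
    by rewrite mulr0 addr0.
  rewrite add0r; have [->|_] := eqVneq l i; last by rewrite mulr0 normr0.
  by rewrite mulr1 normrM ger0_norm // ler_piMl.
have estim e : 0 < e -> exists2 del : R, 0 < del & forall h : 'rV[R]_n, `|h| < del ->
    `|f (x + h) - f x - row_form c h| <= (n%:R * e) * `|h|.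
  move=> e0.
  have : \forall z \near x, U z /\ forall i : 'I_n,
      `|'D_(delta_mx 0 i) f x - 'D_(delta_mx 0 i) f z| < e.
    apply: filterS2 (open_nbhs_nbhs (conj oU Ux)) _; first by move=> z; exact: conj.
    apply: (@filter_forall _ _ _ (nbhs x) _) => i; have [_ [Dc _]] := df i.
    by move: (Dc x Ux) => /cvgrPdist_lt/(_ e e0).
  move=> /nbhs_normP[del /= del0 xdel]; exists del => // h hdel.
  have near z : `|z| <= `|h| -> U (x + z) /\ forall i : 'I_n,
      `|'D_(delta_mx 0 i) f x - 'D_(delta_mx 0 i) f (x + z)| < e.
    move=> zh; apply: xdel; rewrite /= opprD addNKr normrN.
    exact: le_lt_trans hdel.
  have small m : (m <= n)%N -> `|f (x + P m h) - f x - 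
      \sum_(i < n | (i < m)%N) h 0 i * c i| <= (m%:R * e) * `|h|.
    elim: m => [_|m IH mn].
      rewrite big_pred0 // (_ : P 0%N h = 0) ?addr0 ?subrr ?subr0 ?normr0 ?mul0r //.
      by apply/rowP => i; rewrite !mxE.
    set i := Ordinal mn; have [s|s s01 fs] := @mvt_line f (x + P m h) i (h 0 i).
      move=> s01; rewrite -addrA; apply: (df i).1.
      by apply: (near _ _).1; exact: Pball.
    have ds : `|c i - 'D_(delta_mx 0 i) f (x + P m h + (s * h 0 i) *: delta_mx 0 i)| < e.
      by rewrite -addrA; apply: (near _ _).2; exact: Pball.
    rewrite Pm1 addrA (bigD1 i) //= (eq_bigl (fun i : 'I_n => (i < m)%N)); last first.
      move=> j; rewrite ltnS leq_eqVlt -(inj_eq val_inj) /=.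
      by have [->|_] := eqVneq (j : nat) m; rewrite ?ltnn ?andbT.
    rewrite -[f (_ + _ + _)](subrK (f (x + P m h))) fs.
    set S := \sum_(_ | _) _; set Dz := 'D__ f _.
    have -> : h 0 i * Dz + f (x + P m h) - f x - (h 0 i * c i + S) =
      (f (x + P m h) - f x - S) - h 0 i * (c i - Dz) by ring.
    apply: le_trans (ler_normB _ _) _; rewrite -natr1 !mulrDl mul1r.
    apply: lerD (IH (ltnW mn)) _; rewrite normrM mulrC.
    apply: ler_pM => //; [exact: ltW | exact: normr_entry_le].
  have Pn : P n h = h by apply/rowP => i; rewrite !mxE ltn_ord.
  have := small n (leqnn n); rewrite Pn (eq_bigl xpredT) // => i.
  by rewrite ltn_ord.
have dfo e : 0 < e -> \forall h \near (0 : 'rV[R]_n),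
    `|((f \o shift x : _ -> R^o) - (cst (f x) + row_form c)) h| <= e * `|h|.
  move=> e0.
  (* The n coordinate steps add up to n e / (n + 1) <= e; the successor keeps the divisor nonzero in
     dimension 0. *)
  have n0 : 0 < e / n.+1%:R by rewrite divr_gt0.
  have [del del0 hdel] := estim _ n0.
  apply: filterS (nbhs0_lt del0) => h /hdel /=.
  have -> : (f \o shift x - (cst (f x) + row_form c)) h =
      f (x + h) - f x - row_form c h by rewrite /= !fctE /= opprD addrA (addrC h).
  move=> /le_trans; apply; rewrite ler_wpM2r // mulrCA ler_piMr ?ltW //.
  by rewrite ltr_pdivrMr // mul1r ltr_nat.
have rc := @row_form_continuous c.
have dfE := @diff_unique R 'rV[R]_n R^o f (row_form c) x rc ((eqaddoP _ _ _ _).2 dfo).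
apply: (diff_locallyP x (f : _ -> R^o)).2; rewrite dfE.
by split=> //; apply/eqaddoP.
Qed.
End C1Differentiable.

(** * Bump functions and smooth functions on manifolds *)

Section FlatFunction.
Variable R : realType.

(* The functions s^-k e^(-1/s), extended by 0 for s <= 0, are closed under
   differentiation. *)
Definition flat (k : nat) (s : R) : R :=
  if 0 < s then s^-1 ^+ k * expR (- s^-1) else 0.

Lemma flat_gt0 k s : 0 < s -> 0 < flat k s.
Proof.
by move=> s0; rewrite /flat s0 mulr_gt0 ?expR_gt0 // exprn_gt0 // invr_gt0.
Qed.

Lemma flat_le0 k s : s <= 0 -> flat k s = 0.
Proof. by rewrite leNgt /flat => /negbTE ->. Qed.

(** One term of the exponential series bounds s^-(k+2) by (k+2)! e^(1/s). The bound is quadratic so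
    that the difference quotient at 0 tends to 0. *)
Lemma flat_bound k s : `|flat k s| <= k.+2`!%:R * s ^+ 2.
Proof.
have [s0|s0] := ltP 0 s; last by rewrite flat_le0 // normr0 mulr_ge0 // sqr_ge0.
rewrite gtr0_norm ?flat_gt0 // /flat s0 expRN ler_pdivrMr ?expR_gt0 //.
have s'0 : 0 <= s^-1 by rewrite invr_ge0 ltW.
have : s^-1 ^+ k.+2 / k.+2`!%:R <= expR s^-1.
  by apply: le_trans (expR_ge1Dxn k.+1 s'0); rewrite lerDr.
have f0 : (0 : R) < k.+2`!%:R by rewrite ltr0n fact_gt0.
rewrite ler_pdivrMr // => H.
have -> : s^-1 ^+ k = s^-1 ^+ k.+2 * s ^+ 2.
  by rewrite -addn2 exprD -mulrA -exprMn mulVf ?gt_eqF // expr1n mulr1.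
by rewrite [leRHS]mulrAC ler_pM2r ?exprn_gt0 // mulrC.
Qed.

Lemma is_derive_flat k (s : R) :
  is_derive s 1 (flat k) (flat k.+2 s - k%:R * flat k.+1 s).
Proof.
have [s0|s0|->] := ltgtP s 0.
    rewrite !flat_le0 ?ltW // mulr0 subr0.
    apply: near_eq_is_derive (is_derive_cst (0 : R) s 1).
    by near=> t; rewrite flat_le0 // ltW //; near: t; exact: lt_nbhsl.
  have s_neq0 : s != 0 by rewrite gt_eqF.
  have dV : is_derive s 1 (fun t : R => t^-1) (- s ^- 2).
    split; first exact: (@derivableV _ _ (id : R -> R)).
    by rewrite (@deriveV _ _ (id : R -> R)) // derive_id [_ *: 1]mulr1.
  have dX : is_derive s 1 (fun t : R => t^-1 ^+ k) (k%:R * s^-1 ^+ k.-1 * - s ^- 2).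
    by have := @is_deriveX _ _ (fun t : R => t^-1) k s 1 _ dV; rewrite exprfctE.
  have dE : is_derive s 1 (fun t : R => expR (- t^-1)) (expR (- s^-1) * s ^- 2).
    rewrite -[s ^- 2]opprK.
    exact: (@is_derive1_comp R expR (fun t => - t^-1) s _ _ (is_derive_expR _)
            (is_deriveN dV)).
  have := is_deriveM dX dE; set g := (_ * _ : _ -> _) => dg.
  apply: (@near_eq_is_derive _ _ _ g).
    by near=> t; rewrite /flat ifT //; near: t; exact: lt_nbhsr.
  apply: is_derive_eq dg _; rewrite /flat s0 /GRing.scale /=.
  (* The power rule produces the exponent [k.-1], hence the separate case k = 0. *)
  case: k @g dX => [|k] g dX /=; rewrite -?exprVn ?mul0r ?mulr0 ?exprS; ring.
have bound (t : R) : `|t^-1 *: flat k t| <= k.+2`!%:R * `|t|.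
  have [->|t0] := eqVneq t 0; first by rewrite flat_le0 // scaler0 !normr0 mulr0.
  rewrite normrM normfV ler_pdivrMl ?normr_gt0 //.
  apply: le_trans (flat_bound k t) _.
  by rewrite [leRHS]mulrCA -expr2 real_normK ?num_real.
have cv : t^-1 *: ((flat k \o shift 0) (t *: 1) - flat k 0) @[t --> 0^'] --> (0 : R).
  apply/cvgrPdist_le => e e0; near=> t.
  rewrite (flat_le0 k (lexx 0)) subr0 sub0r normrN /= addr0 [_ *: 1]mulr1.
  apply: le_trans (bound t) _.
  rewrite mulrC -ler_pdivlMr ?ltr0n ?fact_gt0 //.
  by near: t; apply: dnbhs0_le; rewrite divr_gt0 // ltr0n fact_gt0.
rewrite !flat_le0 // mulr0 subr0; split; first by apply/cvg_ex; exists 0.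
by apply: cvg_lim.
Unshelve. all: by end_near. Qed.
End FlatFunction.

Lemma differentiable_rV (R : realType) (n m : nat) (F : 'rV[R]_n -> 'rV[R]_m) a :
  (forall j, differentiable (fun v => F v 0 j : R^o) a) -> differentiable F a.
Proof.
move=> dF.
have -> : F = \sum_(j < m) (fun v => (F v 0 j : R) *: (delta_mx 0 j : 'rV[R]_m)).
  by apply/funext => v; rewrite fct_sumE -row_sum_delta.
by apply: differentiable_sum => j; exact: differentiableZl.
Qed.

Section ChartOpen.
Variables (R : realType) (X : topologicalType) (n : nat).
Implicit Types c : chart R X n.

Lemma chart_image_open c W : is_chart c -> open W -> open (ccoord c @` (cdom c `&` W)).
Proof.
move=> [oc oim cK ccont ccinv] oW.
rewrite openE => _ [x [cx Wx] <-].
have imx : (ccoord c @` cdom c) (ccoord c x) by exists x.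
have : nbhs (ccoord c x) (cinv c @^-1` W).
  by apply: (ccinv _ imx); rewrite cK //; exact: open_nbhs_nbhs.
apply: filterS2 (open_nbhs_nbhs (conj oim imx)) => _ [y cy <-].
by rewrite /preimage /= cK // => Wy; exists y.
Qed.
End ChartOpen.

Section SmoothCalculus.
Variables (R : realType) (n : nat) (X : manifold R n).
Implicit Types (U W : set X) (f g : X -> R).

Let atlasP (c : chart R X n) : atlas X c -> is_chart c.
Proof. by move: c; have [_ _ + _ _] := manifoldP X. Qed.

Lemma chart_atP x :
  [/\ atlas X (chart_at x), is_chart (chart_at x) & cdom (chart_at x) x].
Proof.
by have [_ _ _ _ /(_ x)[cX cx]] := manifoldP X; split=> //; exact: atlasP.
Qed.

Lemma smooth_fun_subset U W f : U `<=` W -> smooth_fun W f -> smooth_fun U f.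
Proof.
move=> UW sf c cX k; apply: Ck_subset (sf c cX k) => _ [x [cx Ux] <-].
by exists x => //; split=> //; exact: UW.
Qed.

Lemma smooth_fun_local U f :
  (forall x, U x -> exists2 W, W x & smooth_fun W f) -> smooth_fun U f.
Proof.
move=> locf c cX k; apply: Ck_local => _ [x [cx /locf[W Wx Wf]] <-].
by exists (ccoord c @` (cdom c `&` W)); [exists x | exact: Wf].
Qed.

Lemma eq_smooth_fun U f g : open U -> (forall x, U x -> f x = g x) ->
  smooth_fun U f -> smooth_fun U g.
Proof.
move=> oU fg sf c cX k; have cc := atlasP cX.
apply: eq_Ck (sf c cX k); first exact: chart_image_open.
by have [_ _ cK _ _] := cc; move=> _ [x [cx Ux] <-] /=; rewrite cK // fg.
Qed.

Lemma smooth_fun_cst U (a : R) : smooth_fun U (fun=> a).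
Proof. by move=> c _ k; exact: Ck_cst. Qed.

Lemma smooth_funD U f g : open U -> smooth_fun U f -> smooth_fun U g ->
  smooth_fun U (fun x => f x + g x).
Proof.
move=> oU sf sg c cX k.
by apply: CkD; [exact/chart_image_open/oU/atlasP | exact: sf | exact: sg].
Qed.

Lemma smooth_funM U f g : open U -> smooth_fun U f -> smooth_fun U g ->
  smooth_fun U (fun x => f x * g x).
Proof.
move=> oU sf sg c cX k.
by apply: CkM; [exact/chart_image_open/oU/atlasP | exact: sf | exact: sg].
Qed.

Lemma smooth_funV U f : open U -> (forall x, U x -> f x != 0) -> smooth_fun U f ->
  smooth_fun U (fun x => (f x)^-1).
Proof.
move=> oU f0 sf c cX k; have cc := atlasP cX.
apply: CkV; [exact: chart_image_open | | exact: sf].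
by have [_ _ cK _ _] := cc; move=> _ [x [cx Ux] <-] /=; rewrite cK // f0.
Qed.

Lemma smooth_fun_continuous U f x : open U -> smooth_fun U f -> U x ->
  {for x, continuous f}.
Proof.
move=> oU sf Ux; have [cX cc cx] := chart_atP x; have [oc _ cK ccont _] := cc.
set c := chart_at x in cX cc cx oc cK ccont.
have cf : {for ccoord c x, continuous (f \o cinv c)}.
  by apply: (Ck_continuous (sf c cX 0%N)); exists x.
have fx : (f \o cinv c) (ccoord c x) = f x by rewrite /= cK.
rewrite /prop_for /continuous_at -fx.
apply: cvg_trans (continuous_comp (ccont x cx) cf).
apply: (near_eq_cvg (F := nbhs x)).
by apply: filterS (open_nbhs_nbhs (conj oc cx)) => y cy /=; rewrite cK.
Qed.

Lemma smooth_fun_differentiable U f x : open U -> smooth_fun U f -> U x ->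
  differentiable (f \o cinv (chart_at x) : _ -> R^o) (ccoord (chart_at x) x).
Proof.
move=> oU sf Ux; have [cX cc cx] := chart_atP x.
apply: C1_differentiable (sf _ cX 1%N) _; first exact: chart_image_open.
by exists x.
Qed.

End SmoothCalculus.

Section ChartDifferential.
Variables (R : realType) (n : nat) (X : manifold R n).
Implicit Types c : chart R X n.

Lemma chart_compatible_differentiable c c' x : is_chart c -> is_chart c' ->
  chart_compatible c c' -> cdom c x -> cdom c' x ->
  differentiable (ccoord c' \o cinv c) (ccoord c x).
Proof.
move=> cc cc' comp cx c'x; apply: differentiable_rV => j.
apply: (C1_differentiable _ (comp j 1%N)); last by exists x.
by apply: chart_image_open => //; case: cc'.
Qed.

Lemma dird_chartE c x : is_chart c -> chart_compatible (chart_at x) c -> cdom c x ->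
  dird (ccoord c) x = 'd (ccoord c \o cinv (chart_at x)) (ccoord (chart_at x) x).
Proof.
move=> cc comp cx; have [_ c0c c0x] := chart_atP x; apply/funext => v.
by rewrite /dird deriveE //; exact: chart_compatible_differentiable.
Qed.

(** The opposite transition map S is a left inverse of T near the point, so by the chain rule the
    differential of S is a left inverse of that of T. Injectivity gives bijectivity of the
    trivialisations of the tangent bundle, whose fibres have dimension n. *)
Lemma chart_differential_inj c x : is_chart c -> chart_compatible (chart_at x) c ->
  chart_compatible c (chart_at x) -> cdom c x ->
  injective (linfun (dird (ccoord c) x) : 'Hom('rV[R]_n, 'rV[R]_n)).
Proof.
move=> cc comp comp' cx; rewrite dird_chartE //; have [_ c0c c0x] := chart_atP x.
set c0 := chart_at x in comp comp' c0c c0x *.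
set T := ccoord c \o cinv c0; set a := ccoord c0 x.
pose S := ccoord c0 \o cinv c; have [oc _ cK _ _] := cc; have [oc0 _ c0K _ _] := c0c.
have dT : differentiable T a by exact: chart_compatible_differentiable.
have Ta : T a = ccoord c x by rewrite /T /a /= c0K.
have dS : differentiable S (T a).
  by rewrite Ta; exact: chart_compatible_differentiable.
suff ST v : 'd S (T a) ('d T a v) = v.
  have linE u : (linfun ('d T a) : 'Hom('rV[R]_n, 'rV[R]_n)) u = 'd T a u.
    exact: (lfunE ('d T a : {linear 'rV[R]_n -> 'rV[R]_n})).
  move=> u v Tuv.
  have Tuv' : 'd T a u = 'd T a v by exact: etrans (esym (linE u)) (etrans Tuv (linE v)).
  exact: etrans (esym (ST u)) (etrans (congr1 ('d S (T a)) Tuv') (ST v)).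
have := diff_comp dT dS => /(congr1 (fun f => f v)) /= <-.
have STid : {near a, S \o T =1 id}.
  have oI : open (ccoord c0 @` (cdom c0 `&` cdom c)) by exact: chart_image_open.
  have Ia : (ccoord c0 @` (cdom c0 `&` cdom c)) a by exists x.
  by apply: filterS (open_nbhs_nbhs (conj oI Ia)) => _ [y [c0y cy] <-];
     rewrite /S /T /= c0K // cK.
rewrite -deriveE; last exact: differentiable_comp.
by rewrite (near_eq_derive _ STid) derive_id.
Qed.

Lemma tangent_bundle_lbij (t : triv (tangent_bundle X) n) x :
  trivs (tangent_bundle X) t -> tdom t x -> lbij (tcoord t x).
Proof.
have [_ _ isch comp _] := manifoldP X; have [c0X _ _] := chart_atP x.
case=> c cX <- /= cx; split; last first.
  by apply: lker0_limgf; apply/lker0P; apply: chart_differential_inj => //;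
     [exact: isch | exact: comp | exact: comp].
by apply/eqP/lker0P; apply: chart_differential_inj => //;
     [exact: isch | exact: comp | exact: comp].
Qed.
End ChartDifferential.

(** * Smooth functions on arbitrary subsets *)

Section SmoothOn.
Variables (R : realType) (n : nat) (X : manifold R n).
Implicit Types (A B : set X) (f g : X -> R).

Lemma smooth_on_subset A B f : A `<=` B -> smooth_on B f -> smooth_on A f.
Proof.
move=> AB sf x /AB/sf[W [F [oW Wx sF Ff]]]; exists W, F; split=> // y Wy /AB.
exact: Ff.
Qed.

Lemma smooth_on_local A f :
  (forall x, A x -> exists W, [/\ open W, W x & smooth_on (A `&` W) f]) ->
  smooth_on A f.
Proof.
move=> locf x Ax; have [W [oW Wx /(_ x (conj Ax Wx))]] := locf x Ax.
case=> [W' [F [oW' W'x sF Ff]]]; exists (W `&` W'), F; split=> //.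
- exact: openI.
- by apply: smooth_fun_subset sF => y [].
- by move=> y [Wy W'y] Ay; exact: Ff.
Qed.

Lemma eq_smooth_on A f g : (forall x, A x -> f x = g x) -> smooth_on A f ->
  smooth_on A g.
Proof.
move=> fg sf x /sf[W [F [oW Wx sF Ff]]]; exists W, F; split=> // y Wy Ay.
by rewrite -fg // Ff.
Qed.

Lemma smooth_fun_smooth_on U A f : open U -> A `<=` U -> smooth_fun U f ->
  smooth_on A f.
Proof. by move=> oU AU sf x /AU Ux; exists U, f. Qed.

Lemma smooth_on_cst A (a : R) : smooth_on A (fun=> a).
Proof.
move=> x _; exists setT, (fun=> a); split=> //; first exact: openT.
exact: smooth_fun_cst.
Qed.

Lemma smooth_onD A f g : smooth_on A f -> smooth_on A g ->
  smooth_on A (fun x => f x + g x).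
Proof.
move=> sf sg x Ax.
have [W [F [oW Wx sF Ff]]] := sf x Ax; have [V [H [oV Vx sH Hg]]] := sg x Ax.
have oI : open (W `&` V) by exact: openI.
exists (W `&` V), (fun y => F y + H y); split=> //; last first.
  by move=> y [Wy Vy] Ay; rewrite Ff // Hg.
by apply: smooth_funD => //; [apply: smooth_fun_subset sF | apply: smooth_fun_subset sH];
   move=> y [].
Qed.

Lemma smooth_onM A f g : smooth_on A f -> smooth_on A g ->
  smooth_on A (fun x => f x * g x).
Proof.
move=> sf sg x Ax.
have [W [F [oW Wx sF Ff]]] := sf x Ax; have [V [H [oV Vx sH Hg]]] := sg x Ax.
have oI : open (W `&` V) by exact: openI.
exists (W `&` V), (fun y => F y * H y); split=> //; last first.
  by move=> y [Wy Vy] Ay; rewrite Ff // Hg.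
by apply: smooth_funM => //; [apply: smooth_fun_subset sF | apply: smooth_fun_subset sH];
   move=> y [].
Qed.

Lemma smooth_onN A f : smooth_on A f -> smooth_on A (fun x => - f x).
Proof.
move=> sf; apply: eq_smooth_on (smooth_onM (@smooth_on_cst A (- 1)) sf) => x _.
by rewrite mulN1r.
Qed.

Lemma smooth_on_sum A (I : Type) (r : seq I) (P : pred I) (f : I -> X -> R) :
  (forall i, P i -> smooth_on A (f i)) ->
  smooth_on A (fun x => \sum_(i <- r | P i) f i x).
Proof.
move=> sf; elim: r => [|i r IH].
  by apply: eq_smooth_on (@smooth_on_cst A 0) => x _; rewrite big_nil.
have [Pi|nPi] := boolP (P i); last first.
  by apply: eq_smooth_on IH => x _; rewrite big_cons (negbTE nPi).
apply: eq_smooth_on (smooth_onD (sf i Pi) IH) => x _.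
by rewrite big_cons Pi.
Qed.

Lemma smooth_on_prod A (I : Type) (r : seq I) (P : pred I) (f : I -> X -> R) :
  (forall i, P i -> smooth_on A (f i)) ->
  smooth_on A (fun x => \prod_(i <- r | P i) f i x).
Proof.
move=> sf; elim: r => [|i r IH].
  by apply: eq_smooth_on (@smooth_on_cst A 1) => x _; rewrite big_nil.
have [Pi|nPi] := boolP (P i); last first.
  by apply: eq_smooth_on IH => x _; rewrite big_cons (negbTE nPi).
apply: eq_smooth_on (smooth_onM (sf i Pi) IH) => x _.
by rewrite big_cons Pi.
Qed.

Lemma open_smooth_neq0 W f : open W -> smooth_fun W f ->
  open (W `&` [set y | f y != 0]).
Proof.
move=> oW sf; rewrite openE => y [Wy fy].
apply: filterS2 (open_nbhs_nbhs (conj oW Wy)) _; first by move=> z; exact: conj.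
have := smooth_fun_continuous oW sf Wy => /(_ [set r | r != 0]); apply.
by apply: open_nbhs_nbhs; split=> //; exact: open_neq.
Qed.

Lemma smooth_onV A f : (forall x, A x -> f x != 0) -> smooth_on A f ->
  smooth_on A (fun x => (f x)^-1).
Proof.
move=> f0 sf x Ax; have [W [F [oW Wx sF Ff]]] := sf x Ax.
pose W' := W `&` [set y | F y != 0].
have oW' : open W' by exact: open_smooth_neq0.
exists W', (fun y => (F y)^-1); split=> //.
- by split=> //=; rewrite Ff // f0.
- by apply: smooth_funV => // [y []//|]; apply: smooth_fun_subset sF => y [].
- by move=> y [Wy _] Ay; rewrite Ff.
Qed.

Lemma smooth_on_near_neq0 A f x : smooth_on A f -> A x -> f x != 0 ->
  exists W, [/\ open W, W x & forall y, A y -> W y -> f y != 0].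
Proof.
move=> sf Ax fx; have [W [F [oW Wx sF Ff]]] := sf x Ax.
exists (W `&` [set y | F y != 0]); split.
- exact: open_smooth_neq0.
- by split=> //=; rewrite Ff.
- by move=> y Ay [Wy /=]; rewrite Ff.
Qed.

Lemma smooth_on_det A (r : nat) (C : X -> 'M[R]_r) :
  (forall i j, smooth_on A (fun x => C x i j)) -> smooth_on A (fun x => \det (C x)).
Proof.
move=> sC; rewrite /determinant; apply: smooth_on_sum => s _.
by apply: smooth_onM; [exact: smooth_on_cst | apply: smooth_on_prod].
Qed.

Lemma smooth_on_mulmx A (p q r : nat) (C : X -> 'M[R]_(p, q)) (D : X -> 'M[R]_(q, r)) :
  (forall i j, smooth_on A (fun x => C x i j)) ->
  (forall i j, smooth_on A (fun x => D x i j)) ->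
  forall i j, smooth_on A (fun x => (C x *m D x) i j).
Proof.
move=> sC sD i j.
have : smooth_on A (fun x => \sum_l C x i l * D x l j).
  by apply: smooth_on_sum => l _; exact: smooth_onM.
by apply: eq_smooth_on => x _; rewrite mxE.
Qed.

(** Cramer's rule: the entries are cofactors divided by the determinant. *)
Lemma smooth_on_invmx A (r : nat) (C : X -> 'M[R]_r) :
  (forall x, A x -> C x \in unitmx) ->
  (forall i j, smooth_on A (fun x => C x i j)) ->
  forall i j, smooth_on A (fun x => invmx (C x) i j).
Proof.
move=> uC sC i j.
have : smooth_on A (fun x => (\det (C x))^-1 * cofactor (C x) j i).
  apply: smooth_onM.
    apply: smooth_onV; last exact: smooth_on_det.
    by move=> x /uC; rewrite unitmxE unitfE.
  apply: smooth_onM; first exact: smooth_on_cst.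
  apply: smooth_on_det => k l; apply: eq_smooth_on (sC (lift j k) (lift i l)) => x _.
  by rewrite !mxE.
apply: eq_smooth_on => x /uC ux; rewrite /invmx ux !mxE //.
Qed.
End SmoothOn.

Section SmoothSections.
Variables (R : realType) (n m : nat) (X : manifold R n) (E : vbundle X m).
Implicit Types (A : set X) (s : forall x, E x).

Lemma tframe_expand (t : triv E m) x (e : E x) : lbij (tcoord t x) ->
  e = \sum_j tcoord t x e 0 j *: tframe t j x.
Proof.
move=> [/eqP ker0 _]; rewrite -[LHS](lker0_lfunK ker0) [X in (_^-1)%VF X]row_sum_delta.
by rewrite linear_sum; apply: eq_bigr => j _; rewrite linearZ.
Qed.

Lemma smooth_section_subset A B s : A `<=` B -> smooth_section B s ->
  smooth_section A s.
Proof.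
by move=> AB ss t tE j; apply: smooth_on_subset (ss t tE j) => x [/AB].
Qed.

Lemma smooth_sectionZ A (f : X -> R) s : smooth_on A f -> smooth_section A s ->
  smooth_section A (fun x => f x *: s x).
Proof.
move=> sf ss t tE j.
have sfA : smooth_on (A `&` tdom t) f by apply: smooth_on_subset sf => x [].
apply: eq_smooth_on (smooth_onM sfA (ss t tE j)) => x _.
by rewrite linearZ mxE.
Qed.

Lemma smooth_section_sum A (I : Type) (r : seq I) (s : I -> forall x, E x) :
  (forall i, smooth_section A (s i)) ->
  smooth_section A (fun x => \sum_(i <- r) s i x).
Proof.
move=> ss t tE j.
have : smooth_on (A `&` tdom t) (fun x => \sum_(i <- r) tcoord t x (s i x) 0 j).
  by apply: smooth_on_sum => i _; exact: ss.
by apply: eq_smooth_on => x _; rewrite linear_sum summxE.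
Qed.
End SmoothSections.

Section Morphisms.
Variables (R : realType) (n m m' : nat) (X : manifold R n).
Variables (E : vbundle X m) (F : vbundle X m').
Hypothesis E_lbij : forall t, trivs E t ->
  open (tdom t) /\ forall x, tdom t x -> lbij (tcoord t x).
Hypothesis E_cover : forall x, exists2 t, trivs E t & tdom t x.
Hypothesis F_open : forall t, trivs F t -> open (tdom t).

Lemma smooth_morphism_section A (Phi : forall x, 'Hom(E x, F x)) (s : forall x, E x) :
  smooth_morphism (psi := id) Phi -> smooth_section A s ->
  smooth_section A (fun x => Phi x (s x)).
Proof.
move=> sPhi ss t' t'F j; apply: smooth_on_local => x [Ax t'x].
have [t tE tx] := E_cover x; have [ot tb] := E_lbij tE.
exists (tdom t); split=> //.
have : smooth_on ((A `&` tdom t') `&` tdom t)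
    (fun x => \sum_i tcoord t x (s x) 0 i * tcoord t' x (Phi x (tframe t i x)) 0 j).
  apply: smooth_on_sum => i _; apply: smooth_onM.
    by apply: smooth_on_subset (ss t tE i) => y [[]].
  apply: smooth_fun_smooth_on (sPhi t t' tE t'F i j).
    by apply: openI => //; exact: F_open.
  by move=> y [[]].
apply: eq_smooth_on => y [_ /tb ty].
rewrite [in RHS](tframe_expand (s y) ty) !linear_sum summxE.
by apply: eq_bigr => i _; rewrite !linearZ mxE.
Qed.
End Morphisms.

Section TangentBundle.
Variables (R : realType) (n : nat) (X : manifold R n).

Lemma tangent_bundle_open (t : triv (tangent_bundle X) n) :
  trivs (tangent_bundle X) t -> open (tdom t).
Proof. by case=> c cX <-; have [_ _ /(_ c cX)[]] := manifoldP X. Qed.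

End TangentBundle.

(** * Bump functions in a chart *)

Section Bump.
Variables (R : realType) (n : nat) (X : manifold R n).

Lemma smooth_fun_flat U (f : X -> R) k : open U -> smooth_fun U f ->
  smooth_fun U (fun x => flat k (f x)).
Proof.
move=> oU sf c cX l; have cc : is_chart c by have [_ _ /(_ c cX)] := manifoldP X.
(* This encodes the derivative of [flat k], namely [flat k.+2] minus k times [flat k.+1]. *)
pose succ k := [:: (1 : R, k.+2); (- k%:R, k.+1)].
apply: (@Ck_comp1 R n nat (@flat R) succ setT l k) (sf c cX l) => //.
  exact: chart_image_open.
move=> j s _; rewrite big_cons big_seq1 /= mul1r mulNr; exact: is_derive_flat.
Qed.

Lemma smooth_fun_sum U (I : Type) (r : seq I) (f : I -> X -> R) : open U ->
  (forall i, smooth_fun U (f i)) -> smooth_fun U (fun x => \sum_(i <- r) f i x).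
Proof.
move=> oU sf; elim: r => [|i r IH].
  by apply: eq_smooth_fun (@smooth_fun_cst _ _ _ U 0) => // x _; rewrite big_nil.
apply: eq_smooth_fun (smooth_funD oU (sf i) IH) => // x _.
by rewrite big_cons.
Qed.

Variable c : chart R X n.
Hypothesis c_chart : is_chart c.
Hypothesis c_compat : forall c', atlas X c' -> chart_compatible c' c.

Lemma smooth_coord j : smooth_fun (cdom c) (fun x => ccoord c x 0 j).
Proof. by move=> c' c'X; exact: c_compat. Qed.

(** The function is e^(-1/q) with q = r^2 - |x - a|^2 in coordinates. Its support lies in the
    preimage S of a closed cube, which is compact, hence closed in M because M is Hausdorff;
    closedness of S is what makes extension by zero smooth. *)
Lemma bump_exists x0 : cdom c x0 -> exists (S : set X) (b : X -> R),
  [/\ closed S, S `<=` cdom c, smooth_fun (cdom c) b, b x0 != 0 &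
      forall x, ~ S x -> b x = 0].
Proof.
move=> cx0; have [oc oim cK ccont ccinv] := c_chart; set a := ccoord c x0.
have : nbhs a (ccoord c @` cdom c) by apply: open_nbhs_nbhs; split=> //; exists x0.
move=> /nbhs_ballP[r' /= r'0 ball_im].
(* Half the radius puts the closed cube inside the open max-norm ball contained in the chart
   image. *)
pose r := r' / 2; have r0 : 0 < r by rewrite divr_gt0.
pose I i : set R := `[a 0 i - r, a 0 i + r]%classic.
pose B : set 'rV[R]_n := [set v | forall i, I i (v ord0 i)].
have B_im : B `<=` ccoord c @` cdom c.
  move=> v Bv; apply: ball_im; split=> // i j; rewrite (ord1 i).
  have := Bv j; rewrite /I /= in_itv /= => /andP[l1 l2].
  rewrite -ball_normE /= distrC ltr_distl; rewrite /r in l1 l2; apply/andP; split; lra.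
have B_compact : compact B.
  by apply: rV_compact => i; exact: segment_compact.
pose S := cinv c @` B.
have cpt_S : compact S.
  apply: continuous_compact => //; apply: continuous_in_subspaceT => v.
  by rewrite inE => /B_im; exact: ccinv.
pose q x := r ^+ 2 - \sum_i (ccoord c x 0 i - a 0 i) ^+ 2.
exists S, (fun x => if `[< cdom c x >] then flat 0 (q x) else 0); split.
- by apply: compact_closed cpt_S; case: (manifoldP X).
- by move=> _ [v /B_im[x cx <-] <-]; rewrite cK.
- have sq : smooth_fun (cdom c) q.
    apply: smooth_funD => //; first exact: smooth_fun_cst.
    pose p x := - 1 * \sum_i (ccoord c x 0 i - a 0 i) ^+ 2.
    apply: (eq_smooth_fun (f := p)) => // [x _|]; first by rewrite /p mulN1r.
    apply: smooth_funM => //; first exact: smooth_fun_cst.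
    apply: smooth_fun_sum => // i; set di := fun x => ccoord c x 0 i - a 0 i.
    apply: (smooth_funM (f := di) (g := di)) => //;
      by apply: smooth_funD => //; [exact: smooth_coord | exact: smooth_fun_cst].
  apply: eq_smooth_fun (smooth_fun_flat 0 oc sq) => // x cx.
  by case: asboolP.
- case: asboolP => // _; rewrite gt_eqF // flat_gt0 // /q big1 ?subr0 ?exprn_gt0 //.
  by move=> i _; rewrite subrr expr0n.
- move=> x nSx; case: asboolP => // cx; apply: flat_le0; rewrite /q subr_le0.
  (* A point of the chart with all coordinates within r of those of [x0] is in S; off S, one
     coordinate differs by more than r and makes q nonpositive. *)
  have [i nBi] : exists i, ~ I i (ccoord c x 0 i).
    apply: contra_notP nSx => nex; exists (ccoord c x); last exact: cK.
    by move=> i; apply: contra_notP nex => ni; exists i.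
  rewrite (bigD1 i) //= ler_wpDr ?sumr_ge0 // => [j _|]; first exact: sqr_ge0.
  have : r < `|ccoord c x 0 i - a 0 i|.
    rewrite ltNge ler_distl; apply: contra_notN nBi => /andP[l1 l2].
    by rewrite /I /= in_itv /= l1 l2.
  by move=> rlt; rewrite -[leRHS]real_normK ?num_real // ler_pXn2r ?nnegrE // ltW.
Qed.

(** Smoothness is checked on two open sets covering M: the chart domain, and the complement of the
    closed set S, where the product is zero. *)
Lemma cutoff_coord x0 j : cdom c x0 -> exists (b : X -> R),
  [/\ smooth_fun setT (fun x => b x * ccoord c x 0 j), smooth_fun (cdom c) b, b x0 != 0 &
      forall x, ~ cdom c x -> b x = 0].
Proof.
move=> cx0; have [S [b [cS Sc sb bx0 b0]]] := bump_exists cx0.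
have [oc _ _ _ _] := c_chart.
exists b; split=> // [|x ncx]; last by apply: b0 => /Sc.
have oS : open (~` S) by exact: closed_openC.
apply: smooth_fun_local => x _; have [cx|ncx] := pselect (cdom c x).
  exists (cdom c) => //; apply: smooth_funM => //; exact: smooth_coord.
exists (~` S); first by move=> /Sc.
apply: (eq_smooth_fun (f := fun=> 0)) => //; last exact: smooth_fun_cst.
by move=> y /b0 ->; rewrite mul0r.
Qed.

Lemma dird_coord x v j : cdom c x -> dird (ccoord c) x v 0 j = 
  dird (fun y => ccoord c y 0 j : R^o) x v.
Proof.
move=> cx; rewrite /dird derive_mx ?mxE //; apply/diff_derivable.
have [c0X c0c c0x] := chart_atP x.
by apply: chart_compatible_differentiable => //; exact: c_compat.
Qed.
End Bump.

(** * Nondegenerate forms *)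

Lemma linfun_linear (K : fieldType) (U W : vectType K) (f : U -> W) :
  linear f -> linfun f =1 f.
Proof.
move=> flin.
pose fL : {linear U -> W} := HB.pack f (GRing.isLinear.Build _ _ _ _ f flin).
exact: (lfunE fL).
Qed.

Section NondegenerateForm.
Variables (R : realType) (V : vectType R) (B : V -> V -> R).
Hypothesis Bnd : nondeg_sym B.
Implicit Types U W : {vspace V}.

Lemma form_linearl a u v w : B (a *: u + v) w = a * B u w + B v w.
Proof. by case: Bnd. Qed.

Lemma form_sym u v : B u v = B v u.
Proof. by case: Bnd. Qed.

Lemma form_linearr a u v w : B w (a *: u + v) = a * B w u + B w v.
Proof. by rewrite form_sym form_linearl !(form_sym w). Qed.

Lemma form_linear w : linear (B w : V -> R^o).
Proof. by move=> a u v; rewrite form_linearr. Qed.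

Lemma formDl u v w : B (u + v) w = B u w + B v w.
Proof. by rewrite -{1}(scale1r u) form_linearl mul1r. Qed.

Lemma form0l w : B 0 w = 0.
Proof.
by have := formDl 0 0 w; rewrite addr0 => /eqP; rewrite -subr_eq subrr eq_sym => /eqP.
Qed.

Lemma formZl a u w : B (a *: u) w = a * B u w.
Proof. by rewrite -(addr0 (_ *: _)) form_linearl form0l addr0. Qed.

Lemma formDr u v w : B w (u + v) = B w u + B w v.
Proof. by rewrite form_sym formDl !(form_sym w). Qed.

Lemma formZr a u w : B w (a *: u) = a * B w u.
Proof. by rewrite form_sym formZl !(form_sym w). Qed.

Lemma form0r w : B w 0 = 0.
Proof. by rewrite form_sym form0l. Qed.

Lemma form_sumr (I : Type) (r : seq I) (u : I -> V) w :
  B w (\sum_(i <- r) u i) = \sum_(i <- r) B w (u i).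
Proof. by elim: r => [|i r IH]; rewrite ?big_nil ?form0r // !big_cons formDr IH. Qed.

Lemma form_suml (I : Type) (r : seq I) (u : I -> V) w :
  B (\sum_(i <- r) u i) w = \sum_(i <- r) B (u i) w.
Proof. by rewrite form_sym form_sumr; apply: eq_bigr => i _; exact: form_sym. Qed.

Lemma form_eq0 v : (forall w, B v w = 0) -> v = 0.
Proof. by case: Bnd => _ _ /(_ v). Qed.

(** Nondegeneracy makes v |-> B v injective from V to its dual, and the dimensions agree. *)
Lemma riesz (xi : 'Hom(V, R^o)) : exists v, forall w, B v w = xi w.
Proof.
pose Phi : 'Hom(V, 'Hom(V, R^o)) := linfun (fun v => linfun (B v : V -> R^o)).
have PhiE v : Phi v = linfun (B v : V -> R^o).
  rewrite linfun_linear // => a u w; apply/lfunP => z.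
  rewrite add_lfunE scale_lfunE !linfun_linear; last 3 first.
  - exact: form_linear.
  - exact: form_linear.
  - exact: form_linear.
  by rewrite form_linearl.
have Phi0 : lker Phi == 0%VS.
  apply/lker0P => u v; rewrite !PhiE => /lfunP Buv.
  apply/eqP; rewrite -subr_eq0 -scaleN1r addrC; apply/eqP/form_eq0 => w.
  have := Buv w; rewrite !linfun_linear; try exact: form_linear.
  by rewrite form_linearl => ->; rewrite mulN1r addNr.
have : limg Phi = fullv.
  apply/eqP; rewrite eqEdim subvf /= limg_dim_eq; last by rewrite (eqP Phi0) capv0.
  by rewrite !dimvf /dim /= muln1.
move=> imgf; have : xi \in limg Phi by rewrite imgf memvf.
case/memv_imgP => v _ ->; exists v => w; rewrite PhiE linfun_linear //.
exact: form_linear.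
Qed.

(** By [riesz] the set in the definition of [costar] is inhabited, so the default value 0 is never
    taken. *)
Lemma costarP (T : vectType R) (p : 'Hom(V, T)) (xi : 'Hom(T, R^o)) e :
  B (costar B p xi) e = xi (p e).
Proof.
rewrite /costar; case: xgetP => [v _ /(_ e)//|noV].
have [v vE] := riesz (xi \o p)%VF.
by case: (noV v) => w; rewrite vE comp_lfunE.
Qed.

Lemma mem_orth U v : v \in orth B U <-> forall w, w \in U -> B v w = 0.
Proof.
apply: mem_vsub => [w _|a u v' Bu Bv' w wU]; first exact: form0l.
by rewrite form_linearl Bu // Bv' // mulr0 addr0.
Qed.

Lemma orthS U W : (U <= W)%VS -> (orth B W <= orth B U)%VS.
Proof.
move=> /subvP UW; apply/subvP => v /mem_orth Bv; apply/mem_orth => w /UW; exact: Bv.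
Qed.

Lemma orth_add U W : orth B (U + W) = (orth B U :&: orth B W)%VS.
Proof.
apply/eqP; rewrite eqEsubv subv_cap !orthS ?addvSl ?addvSr //=.
apply/subvP => v; rewrite memv_cap => /andP[/mem_orth BU /mem_orth BW].
by apply/mem_orth => _ /memv_addP[u uU [w wW ->]]; rewrite formDr BU // BW // addr0.
Qed.

Lemma orth_fullv : orth B fullv = 0%VS.
Proof.
apply/eqP; rewrite -subv0; apply/subvP => v /mem_orth Bv; rewrite memv0; apply/eqP.
by apply: form_eq0 => w; apply: Bv; exact: memvf.
Qed.

Lemma sub_orthK U : (U <= orth B (orth B U))%VS.
Proof.
by apply/subvP => u uU; apply/mem_orth => w /mem_orth/(_ u uU); rewrite form_sym.
Qed.

Lemma dim_orth_ge U : (\dim {: V} <= \dim (orth B U) + \dim U)%N.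
Proof.
pose b := vbasis U.
pose T : 'Hom(V, 'rV[R]_(\dim U)) := linfun (fun v => \row_i B v b`_i).
have TE v : T v = \row_i B v b`_i.
  rewrite linfun_linear // => a u w; apply/rowP => i.
  by rewrite !mxE form_linearl.
have <- : lker T = orth B U.
  apply/vspaceP => v; apply/idP/idP.
    rewrite memv_ker TE => /eqP/rowP Tv; apply/mem_orth => w wU.
    rewrite (coord_vbasis wU) form_sumr big1 // => i _.
    by have := Tv i; rewrite !mxE formZr => ->; rewrite mulr0.
  move=> /mem_orth Bv; rewrite memv_ker TE; apply/eqP/rowP => i; rewrite !mxE.
  by apply: Bv; apply: vbasis_mem; rewrite mem_nth ?size_tuple.
have := limg_ker_dim T fullv; rewrite capfv => <-.
rewrite leq_add2l; apply: leq_trans (dimvS (subvf _)) _.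
by rewrite dimvf /dim /= mul1n.
Qed.

(** The upper bound comes from a complement of U: its orthogonal meets that of U trivially, as
    together they annihilate V, and by [dim_orth_ge] it has dimension at least dim U. *)
Lemma dim_orth U : (\dim (orth B U) + \dim U = \dim {: V})%N.
Proof.
apply/eqP; rewrite eqn_leq dim_orth_ge andbT.
have disj : (orth B U :&: orth B U^C = 0)%VS.
  by rewrite -orth_add addv_complf orth_fullv.
have := dimv_disjoint_sum disj; have := dimvS (subvf (orth B U + orth B U^C)).
have := dim_orth_ge U^C; rewrite dimv_compl.
have := dimvS (subvf U); lia.
Qed.

Lemma orthK U : orth B (orth B U) = U.
Proof.
apply/eqP; rewrite eq_sym eqEdim sub_orthK /=.
by have := dim_orth U; have := dim_orth (orth B U); lia.
Qed.

Lemma isotropic_sub_orth U : isotropic B U -> (U <= orth B U)%VS.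
Proof. by move=> iU; apply/subvP => v vU; apply/mem_orth => w; exact: iU. Qed.

Lemma lagrangian_dim U : U = orth B U -> (\dim U + \dim U = \dim {: V})%N.
Proof. by move=> UE; have := dim_orth U; rewrite -UE. Qed.

(** * Linear algebra of the perturbation in one fibre *)

Section Perturbation.
Variables L K D : {vspace V}.
Hypothesis L_lagr : L = orth B L.
Hypothesis D_isotropic : isotropic B D.
Hypothesis LK_D_span : (orth B (L :&: K) + D = fullv)%VS.
Hypothesis LK_D_cap : (orth B (L :&: K) :&: D = 0)%VS.

Lemma perturbation_capL : (L :&: D = 0)%VS.
Proof.
by apply/eqP; rewrite -subv0 -LK_D_cap capvS // {1}L_lagr orthS // capvSl.
Qed.

(** With L = L^perp, the orthogonal of L cap D^perp + D is (L + D) cap D^perp; as D lies in D^perp,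
    the modular law turns this back into L cap D^perp + D. *)
Lemma perturbation_lagrangian :
  (L :&: orth B D + D)%VS = orth B (L :&: orth B D + D).
Proof.
have DD := isotropic_sub_orth D_isotropic.
have -> : (L :&: orth B D)%VS = orth B (L + D) by rewrite orth_add -L_lagr.
rewrite [RHS]orth_add orthK orth_add -L_lagr (addvC L).
by rewrite addvC vspace_modl.
Qed.

(** The common core of (i) and (ii): l pairs to zero with L cap K because L is isotropic, so e lies
    in (L cap K)^perp cap D = 0. *)
Lemma perturbation_isotropic_part l e : l \in L -> e \in D ->
  (forall w, w \in (L :&: K)%VS -> B (l + e) w = 0) -> e = 0.
Proof.
move=> lL eD Bw; apply/eqP; rewrite -memv0 -LK_D_cap memv_cap eD andbT.
apply/mem_orth => w wLK; rewrite -(Bw w wLK) formDl.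
suff -> : B l w = 0 by rewrite add0r.
by move: lL; rewrite L_lagr => /mem_orth; apply; move: wLK => /memv_capP[].
Qed.

Hypothesis K_isotropic : isotropic B K.

Lemma perturbation_capK : ((L :&: orth B D + D) :&: K = 0)%VS.
Proof.
apply/eqP; rewrite -subv0; apply/subvP => v /memv_capP[/memv_addP].
case=> l /memv_capP[lL lD] [e eD ->] leK.
have e0 : e = 0.
  apply: (perturbation_isotropic_part lL eD) => w /memv_capP[_ wK].
  exact: K_isotropic.
(* What remains is l in L cap K orthogonal to D, hence orthogonal to (L cap K)^perp + D, the whole
   space. *)
rewrite e0 addr0 in leK *; rewrite -orth_fullv -LK_D_span.
by rewrite orth_add orthK !memv_cap lL leK.
Qed.

Lemma perturbation_reduction :
  ((L :&: orth B D + D) :&: orth B K + K = L :&: orth B K + K)%VS.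
Proof.
apply/eqP; rewrite eqEsubv !subv_add !addvSr !andbT; apply/andP; split.
  apply/subvP => v /memv_capP[/memv_addP[l /memv_capP[lL lD] [e eD ->]]].
  move=> /mem_orth leK; have e0 : e = 0.
    apply: (perturbation_isotropic_part lL eD) => w /memv_capP[_ wK].
    exact: leK.
  rewrite e0 addr0 in leK *; apply: (subvP (addvSl _ _)).
  by rewrite memv_cap lL; apply/mem_orth.
(* Taking orthogonals in (L cap K)^perp cap D = 0 gives D^perp + (L cap K) = V. A vector v of L cap
   K^perp then splits as u + w with w in K and u = v - w still in L cap K^perp. *)
have span : (orth B D + (L :&: K) = fullv)%VS.
  rewrite -[LHS]orthK orth_add orthK capvC LK_D_cap.
  apply/vspaceP => v; rewrite memvf; apply/mem_orth => w.
  by rewrite memv0 => /eqP ->; exact: form0r.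
apply/subvP => v /memv_capP[vL vK].
have : v \in (orth B D + (L :&: K))%VS by rewrite span memvf.
case/memv_addP => u uD [w /memv_capP[wL wK] vE].
have uE : u = v - w by rewrite vE addrK.
rewrite vE; apply: memv_add => //.
rewrite memv_cap (subvP (addvSl _ _)) /=; last by rewrite memv_cap uD uE rpredB.
rewrite uE rpredB //.
exact: (subvP (isotropic_sub_orth K_isotropic)).
Qed.
End Perturbation.
End NondegenerateForm.

(** * Isotropy of K *)

Section CourantForm.
Variables (R : realType) (n m : nat) (M : manifold R n) (E : exactCourant M m).

Let Bnd x : nondeg_sym (@cform _ _ _ _ E x). Proof. exact: courant_form. Qed.

Lemma pstarP x xi (e : E x) : cform (pstar E x xi) e = xi (anchor E x e).
Proof. exact: costarP. Qed.

Lemma anchor_pstar x xi : anchor E x (pstar E x xi) = 0.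
Proof. by apply: (courant_exact_m _).2; exists xi. Qed.

Lemma pstar_linear x : linear (pstar E x).
Proof.
move=> a xi eta; apply/eqP; rewrite -subr_eq0 -scaleN1r; apply/eqP.
apply: (form_eq0 (Bnd x)) => w.
rewrite (formDl (Bnd x)) (formZl (Bnd x)) (formDl (Bnd x)) (formZl (Bnd x)) !pstarP.
by rewrite add_lfunE scale_lfunE mulN1r subrr.
Qed.

Lemma cform_smooth A (s s' : forall x, E x) : smooth_section A s ->
  smooth_section A s' -> smooth_on A (fun x => cform (s x) (s' x)).
Proof.
have [E_lbij E_cover _] := courant_bundle E.
move=> ss ss'; apply: smooth_on_local => x Ax.
have [t tE tx] := E_cover x; have [ot tb] := E_lbij t tE.
exists (tdom t); split=> //.
have : smooth_on (A `&` tdom t) (fun x => \sum_i \sum_j tcoord t x (s x) 0 i *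
    (tcoord t x (s' x) 0 j * cform (tframe t i x) (tframe t j x))).
  apply: smooth_on_sum => i _; apply: smooth_on_sum => j _.
  apply: smooth_onM; first exact: ss.
  apply: smooth_onM; first exact: ss'.
  by apply: smooth_fun_smooth_on (courant_form_smooth tE i j) => // y [].
apply: eq_smooth_on => y [_ /tb ty].
rewrite [in RHS](tframe_expand (s y) ty) [in RHS](tframe_expand (s' y) ty).
rewrite (form_suml (Bnd y)); apply: eq_bigr => i _.
rewrite (form_sumr (Bnd y)); apply: eq_bigr => j _.
by rewrite (formZl (Bnd y)) (formZr (Bnd y)).
Qed.
End CourantForm.

Section LiftedActionFacts.
Variables (R : realType) (n m k d : nat) (M : manifold R n) (E : exactCourant M m).
Variables (G : lieGroup R k) (A : liftedAction E G) (N : set M).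

Let actM g h x : act A (gmul g h) x = act A g (act A h x).
Proof.
by have /(congr1 (@projT1 _ _)) := lact_mul A g h (existT (fun x : M => E x) x 0).
Qed.

Let act1 x : act A (gone G) x = x.
Proof.
by have /(congr1 (@projT1 _ _)) := lact_one A (existT (fun x : M => E x) x 0).
Qed.

Lemma actVK g x : act A (ginv g) (act A g x) = x.
Proof. by rewrite -actM gmulV act1. Qed.

Lemma actKV g x : act A g (act A (ginv g) x) = x.
Proof. by rewrite -[LHS](actVK (ginv g)) (actVK g) actVK. Qed.

(** Supplies the translated sections that [lact_infinitesimal] asks for. The value lies over g (g^-1
    y), equal to y only propositionally, so it is transported; at y = g x proof irrelevance removes
    the transport. *)
Lemma push_section g (e : forall x, E x) : exists e', pushes (Act A g) e e'.
Proof.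
pose e' y := eq_rect _ (fun z => E z) (Act A g _ (e (act A (ginv g) y))) y (actKV g y).
exists e' => x; rewrite /e'; move: (actKV g (act A g x)); rewrite actVK => p.
by rewrite (Prop_irrelevance p erefl).
Qed.

Hypothesis N_invariant : invariant_set A N.

Lemma push_section_eq0 g (e e' : forall x, E x) x : (forall y, N y -> e y = 0) ->
  pushes (Act A g) e e' -> N x -> e' x = 0.
Proof.
move=> e0 ee' Nx; rewrite -(actKV g x) ee' e0 ?linear0 //.
exact: N_invariant.
Qed.

(* Differentiating g |-> (g . (f chi(u)))(x) = 0 and applying the Leibniz rule
   to [[chi u, f chi u]]. *)
Lemma dird_anchor_chi (f : M -> R) u x : smooth_fun setT f ->
  (forall y, N y -> f y = 0) -> N x -> dird f x (anchor E x (chi A u x)) = 0.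
Proof.
move=> sf f0 Nx; pose e y := f y *: chi A u y.
have Ge : Gamma e.
  apply: smooth_sectionZ; last exact: chi_section.
  by apply: smooth_fun_smooth_on sf => //; exact: openT.
have e0 y : N y -> e y = 0 by move=> Ny; rewrite /e f0 // scale0r.
have [eg ege] := choice (fun g => push_section g e).
set w := dird f x _.
(* If chi(u) vanishes at x, the direction of differentiation is zero, and so is w. *)
suff : w *: chi A u x = 0.
  move=> /eqP; rewrite scaler_eq0 => /orP[/eqP //|/eqP chi0].
  by rewrite /w chi0 linear0 /dird derive0.
have -> : w *: chi A u x = cbracket (chi A u) e x.
  rewrite (courant_leibniz sf) ?f0 ?scale0r ?add0r //; exact: chi_section.
(* The infinitesimal action is known only through linear functionals; pairings with all v suffice by
   nondegeneracy. *)
apply: (form_eq0 (courant_form E x)) => v.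
have := lact_infinitesimal u Ge ege (linfun (@cform _ _ _ _ E x v : E x -> R^o)).
rewrite linfun_linear; last exact: (form_linear (courant_form E x)).
rewrite (form_sym (courant_form E x)) => <-.
rewrite /dird (_ : _ \o _ = cst 0) ?derive_cst //; apply/funext => y /=.
by rewrite (push_section_eq0 e0 (ege _) Nx) linear0.
Qed.

Hypothesis N_submanifold : submanifold N d.

(** A transverse slice coordinate times the bump b vanishes on all of N. Since the coordinate is
    zero at x, the product rule leaves b(x) times its derivative, and b(x) is nonzero. *)
Lemma anchor_chi_tangent u x : N x -> tangent_sub N d x (anchor E x (chi A u x)).
Proof.
move=> Nx; have [_ /(_ x Nx)[c [[cc comp slice] cx]]] := N_submanifold.
exists c; split=> // j dj.
have c_compat c' : atlas M c' -> chart_compatible c' c by move=> /comp[].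
have [b [sbc sb bx b0]] := cutoff_coord cc c_compat j cx.
have fN y : N y -> b y * ccoord c y 0 j = 0.
  move=> Ny; have [cy|/b0 ->] := pselect (cdom c y); last by rewrite mul0r.
  by rewrite ((slice y cy).1 Ny) // mulr0.
have := dird_anchor_chi u sbc fN Nx; set v := anchor _ _ _.
rewrite dird_coord //.
have oc : open (cdom c) by case: cc.
have db := smooth_fun_differentiable oc sb cx.
have dc := smooth_fun_differentiable oc (smooth_coord c_compat j) cx.
rewrite /dird; set a := ccoord (chart_at x) x in db dc *.
have ax : cinv (chart_at x) a = x.
  by have [_ [_ _ K _ _] cx'] := chart_atP x; rewrite /a K.
have -> : (fun y => b y * ccoord c y 0 j) \o cinv (chart_at x) =
   (b \o cinv (chart_at x)) * ((fun y => ccoord c y 0 j) \o cinv (chart_at x)) by [].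
rewrite deriveM; [|exact: diff_derivable..].
rewrite /= ax ((slice x cx).1 Nx) // scale0r addr0 => /eqP.
by rewrite scaler_eq0 (negbTE bx) => /eqP.
Qed.

Lemma mem_Kbundle x v : v \in Kbundle A N d x <-> exists u (xi : 'Hom('rV[R]_n, R^o)),
  (forall w, tangent_sub N d x w -> xi w = 0) /\ v = chi A u x + pstar E x xi.
Proof.
apply: mem_vsub.
  exists 0, 0; split=> [w _|]; first by rewrite zero_lfunE.
  have p0 := @pstar_linear _ _ _ _ E x (-1) 0 0.
  have c0 := chi_linear A (-1) 0 0 x.
  by rewrite !scaleN1r !addNr in p0 c0; rewrite p0 c0 addr0.
move=> a _ _ [u [xi [xi0 ->]]] [u' [xi' [xi'0 ->]]].
exists (a *: u + u'), (a *: xi + xi'); split.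
  by move=> w Tw; rewrite add_lfunE scale_lfunE xi0 // xi'0 // scaler0 addr0.
by rewrite chi_linear pstar_linear scalerDr addrACA.
Qed.

Hypothesis A_isotropic : isotropic_action A.

Lemma Kbundle_isotropic : isotropic_on N (Kbundle A N d).
Proof.
have Bnd x := courant_form E x.
(* Polarisation: isotropy of the action is stated for the quadratic form only. *)
have chichi u u' x : cform (chi A u x) (chi A u' x) = 0.
  have := A_isotropic (1 *: u + u') x; rewrite chi_linear.
  rewrite (form_linearl (Bnd x)) !(form_linearr (Bnd x)) !mul1r !A_isotropic.
  rewrite (form_sym (Bnd x) (chi A u' x)) add0r addr0 => /eqP.
  by rewrite -mulr2n mulrn_eq0 => /eqP.
move=> x Nx _ _ /mem_Kbundle[u [xi [xi0 ->]]] /mem_Kbundle[u' [xi' [xi'0 ->]]].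
rewrite !(formDl (Bnd x)) !(formDr (Bnd x)) chichi add0r.
rewrite (form_sym (Bnd x) (chi A u x)) !pstarP anchor_pstar linear0 addr0.
by rewrite xi0 ?xi'0 ?addr0 //; exact: anchor_chi_tangent.
Qed.
End LiftedActionFacts.

(** * Spinors *)

Section AlternatingForms.
Variables (R : realType) (T : vectType R).
Implicit Types (al be : xform T) (s : 'Hom(T, R^o)) (x y : T).

(** Alternation in a single degree, so that it can be asserted of a form with its first argument
    frozen. *)
Definition alternating_at (k : nat) (f : ('I_k -> T) -> R) :=
  (forall (v : 'I_k -> T) i a x y,
     f (upd v i (a *: x + y)) = a * f (upd v i x) + f (upd v i y)) /\
  (forall (v : 'I_k -> T) i j, i != j -> v i = v j -> f v = 0).

Lemma vcons_eta k (v : 'I_k.+1 -> T) :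
  v = vcons (v ord0) (fun j => v (lift ord0 j)).
Proof. by apply/funext => i; rewrite /vcons; case: unliftP => [j ->|->]. Qed.

Lemma vcons0 k x (v : 'I_k -> T) : vcons x v ord0 = x.
Proof. by rewrite /vcons unlift_none. Qed.

Lemma vconsS k x (v : 'I_k -> T) j : vcons x v (lift ord0 j) = v j.
Proof. by rewrite /vcons liftK. Qed.

Lemma upd_vcons0 k x y (v : 'I_k -> T) : upd (vcons x v) ord0 y = vcons y v.
Proof.
apply/funext => i; rewrite /upd; case: (unliftP ord0 i) => [j ->|->].
  by rewrite eq_sym (negbTE (neq_lift _ _)) !vconsS.
by rewrite eqxx vcons0.
Qed.

Lemma upd_vconsS k x y (v : 'I_k -> T) j :
  upd (vcons x v) (lift ord0 j) y = vcons x (upd v j y).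
Proof.
apply/funext => i; rewrite /upd; case: (unliftP ord0 i) => [l ->|->].
  by rewrite !vconsS (inj_eq lift_inj).
by rewrite (negbTE (neq_lift _ _)) !vcons0.
Qed.

Lemma upd_id k (v : 'I_k -> T) i : upd v i (v i) = v.
Proof. by apply/funext => j; rewrite /upd; case: eqP => [->|]. Qed.

Lemma updC k (v : 'I_k -> T) i j x y : i != j ->
  upd (upd v i x) j y = upd (upd v j y) i x.
Proof.
move=> ij; apply/funext => l; rewrite /upd.
by case: eqP => [->|//]; rewrite eq_sym (negbTE ij).
Qed.

Lemma alternating_at_swap k (f : ('I_k -> T) -> R) v i j x y : alternating_at f ->
  i != j -> f (upd (upd v i x) j y) = - f (upd (upd v i y) j x).
Proof.
move=> [flin falt] ij.
have lj p a b : f (upd (upd v i p) j (a + b)) =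
    f (upd (upd v i p) j a) + f (upd (upd v i p) j b).
  by have := flin (upd v i p) j 1 a b; rewrite scale1r mul1r.
have li p a b : f (upd (upd v i (a + b)) j p) =
    f (upd (upd v i a) j p) + f (upd (upd v i b) j p).
  by have := flin (upd v j p) i 1 a b; rewrite scale1r mul1r !(@updC _ v j i) // eq_sym.
have z p : f (upd (upd v i p) j p) = 0.
  by apply: (falt _ i j ij); rewrite /upd !eqxx (negbTE ij).
have := z (x + y); rewrite li !lj !z add0r addr0 => /eqP.
by rewrite addr_eq0 => /eqP.
Qed.

(* Reduces alternation of a wedge product to contractions, without signs of
   cyclic permutations. *)
Lemma alternating_at_vcons k (f : ('I_k.+1 -> T) -> R) :
  (forall a x y w, f (vcons (a *: x + y) w) = a * f (vcons x w) + f (vcons y w)) ->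
  (forall x, alternating_at (fun w => f (vcons x w))) ->
  (forall x (w : 'I_k -> T) (i : 'I_k), w i = x -> i = 0%N :> nat -> f (vcons x w) = 0) ->
  alternating_at f.
Proof.
move=> flin falt f0; split=> [v i a x y|].
  rewrite (vcons_eta v); case: (unliftP ord0 i) => [j ->|->].
    by rewrite !upd_vconsS; apply: (falt _).1.
  by rewrite !upd_vcons0.
(* The third hypothesis covers equality of slots 0 and 1 only; a matching entry further on is first
   exchanged with the head of w, at the cost of a sign. *)
have head v j : v ord0 = v (lift ord0 j) -> f v = 0.
  rewrite (vcons_eta v) vcons0 vconsS; set x := v ord0; set w := fun _ => _ => xw.
  case: k f flin falt f0 v j @x @w xw => [|k] f flin falt f0 v j x w xw.
    by case: j {xw}.
  have [j0|j0] := eqVneq j ord0; first by apply: f0 (esym xw) _; rewrite j0.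
  have -> : w = upd (upd w ord0 (w ord0)) j x by rewrite upd_id xw upd_id.
  have := alternating_at_swap w (w ord0) x (falt x) _ => /(_ ord0 j) ->; last first.
    by rewrite eq_sym.
  rewrite (f0 x _ ord0) ?oppr0 // /upd eqxx.
  by rewrite eq_sym (negbTE j0).
move=> v i j ij vij.
case: (unliftP ord0 i) ij vij => [i' ->|->]; case: (unliftP ord0 j) => [j' ->|->] //.
- rewrite (inj_eq lift_inj) => ij vij; rewrite (vcons_eta v).
  exact: (falt _).2 ij vij.
- by move=> _ /esym; exact: head.
- by move=> _; exact: head.
Qed.

Lemma interior_alternating x al : alternating al -> alternating (interior x al).
Proof.
move=> alA k; have [lin alt] := alA k.+1; split=> [v i a y z|v i j ij vij].
  by have := lin (vcons x v) (lift ord0 i) a y z; rewrite !upd_vconsS.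
rewrite /interior; apply: (alt _ (lift ord0 i) (lift ord0 j)).
  by rewrite (inj_eq lift_inj).
by rewrite !vconsS.
Qed.

Lemma interior_linear a x y al : alternating al ->
  interior (a *: x + y) al = xadd (xscale a (interior x al)) (interior y al).
Proof.
move=> alA; apply: functional_extensionality_dep => k; apply/funext => w.
rewrite /xadd /xscale /interior; have [lin _] := alA k.+1.
by have := lin (vcons 0 w) ord0 a x y; rewrite !upd_vcons0.
Qed.

Lemma interior_anticomm x y al k (w : 'I_k -> T) : alternating al ->
  interior x (interior y al) w = - interior y (interior x al) w.
Proof.
move=> alA; rewrite /interior.
have E u v : vcons u (vcons v w) = upd (upd (vcons 0 (vcons 0 w)) ord0 u) (lift ord0 ord0) v.
  by rewrite upd_vcons0 upd_vconsS upd_vcons0.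
by rewrite (E x y) (E y x) (alternating_at_swap _ _ _ (alA k.+2)).
Qed.

(** Contraction is an antiderivation: the term i = 0 of the sum gives s(x), and the others carry one
    extra sign. This identity drives the inductions on the degree. *)
Lemma interior_wedge1 x s al : interior x (wedge1 s al) =
  xadd (xscale (s x) al) (xscale (- 1) (wedge1 s (interior x al))).
Proof.
apply: functional_extensionality_dep => k; apply/funext => w.
rewrite /xadd /xscale {1}/interior /= big_ord_recl /= expr0 mul1r vcons0.
congr (_ * al k _ + _).
  by apply/funext => j; rewrite vconsS.
case: k w => [|k] w; first by rewrite big_ord0 mulr0.
rewrite mulN1r -sumrN; apply: eq_bigr => i _.
rewrite /bump /= add1n exprS mulN1r vconsS -!mulNr; congr (_ * _).
rewrite /interior; congr (al _ _); apply/funext => j.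
rewrite /vcons; case: (unliftP ord0 j) => [l ->|->].
  have -> : lift (lift ord0 i) (lift ord0 l) = lift ord0 (lift i l).
    by apply: val_inj; rewrite /= /bump !add1n ltnS addnS.
  by rewrite !liftK.
have -> : lift (lift ord0 i) ord0 = ord0 by apply: val_inj.
by rewrite !unlift_none.
Qed.

Lemma interior_xadd x al be :
  interior x (xadd al be) = xadd (interior x al) (interior x be).
Proof. by []. Qed.

Lemma wedge1_xadd s al be : wedge1 s (xadd al be) = xadd (wedge1 s al) (wedge1 s be).
Proof.
apply: functional_extensionality_dep => -[|k]; apply/funext => w.
  by rewrite /xadd addr0.
rewrite /xadd /= -big_split; apply: eq_bigr => i _ /=; exact: mulrDr.
Qed.

Lemma wedge1_xscale s a al : wedge1 s (xscale a al) = xscale a (wedge1 s al).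
Proof.
apply: functional_extensionality_dep => -[|k]; apply/funext => w.
  by rewrite /xscale mulr0.
rewrite /xscale /= mulr_sumr; apply: eq_bigr => i _ /=; exact: mulrCA.
Qed.

Lemma wedge1_linear a s t al :
  wedge1 (a *: s + t) al = xadd (xscale a (wedge1 s al)) (wedge1 t al).
Proof.
apply: functional_extensionality_dep => -[|k]; apply/funext => w.
  by rewrite /xadd /xscale mulr0 addr0.
rewrite /xadd /xscale /= mulr_sumr -big_split; apply: eq_bigr => i _ /=.
rewrite add_lfunE scale_lfunE /GRing.scale /=; ring.
Qed.

Lemma xadd_alternating al be : alternating al -> alternating be ->
  alternating (xadd al be).
Proof.
move=> alA beA k; have [l1 a1] := alA k; have [l2 a2] := beA k.
split=> [v i a x y|v i j ij vij]; rewrite /xadd; first by rewrite l1 l2; ring.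
by rewrite (a1 _ _ _ ij) // (a2 _ _ _ ij) // addr0.
Qed.

Lemma xscale_alternating a al : alternating al -> alternating (xscale a al).
Proof.
move=> alA k; have [l1 a1] := alA k.
split=> [v i b x y|v i j ij vij]; rewrite /xscale; first by rewrite l1; ring.
by rewrite (a1 _ _ _ ij) // mulr0.
Qed.

Lemma wedge1_alternating s al : alternating al -> alternating (wedge1 s al).
Proof.
move=> alA k; elim: k al alA => [|k IH] al alA; first by split=> v [].
have intE x w : wedge1 s al (vcons x w) =
    s x * al k w - wedge1 s (interior x al) w.
  have := congr1 (fun f : xform T => f k w) (interior_wedge1 x s al).
  by rewrite {1}/interior => ->; rewrite /xadd /xscale mulN1r.
apply: alternating_at_vcons => [a x y w|x|x w i wi i0].
- rewrite !intE interior_linear // wedge1_xadd wedge1_xscale /xadd /xscale.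
  rewrite linearP /= /GRing.scale /=; ring.
- have [l1 a1] := alA k; have [l2 a2] := IH _ (interior_alternating x alA).
  split=> [v i a y z|v i j ij vij]; rewrite !intE.
    by rewrite l1 l2; ring.
  by rewrite (a1 _ _ _ ij) // (a2 _ _ _ ij) // mulr0 subrr.
(* For equal first two slots, expanding twice gives s(x) i_x al - s(x) i_x al + s wedge (i_x i_x
   al), and i_x i_x al = 0. *)
- case: k w i wi i0 {IH} intE => [|k] w i; first by case: i.
  move=> wi i0 intE; rewrite intE (vcons_eta w).
  have -> : w ord0 = x by rewrite -wi; congr (w _); exact: val_inj.
  have := congr1 (fun f : xform T => f k (fun j => w (lift ord0 j)))
             (interior_wedge1 x s (interior x al)).
  rewrite {1}/interior => ->; rewrite /xadd /xscale.
  have -> : interior x (interior x al) = @xzero R T.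
    apply: functional_extensionality_dep => l; apply/funext => u.
    have [_ alt] := alA l.+2; rewrite /interior.
    by apply: (alt _ ord0 (lift ord0 ord0)) => //; rewrite vconsS !vcons0.
  have -> : wedge1 s (@xzero R T) = @xzero R T.
    apply: functional_extensionality_dep => -[//|l]; apply/funext => u.
    by rewrite /wedge1 big1 // => p _; rewrite mulr0.
  by rewrite /interior /xzero mulr0 addr0 subrr.
Qed.

Lemma wedge1_anticomm s t al k (w : 'I_k -> T) :
  wedge1 s (wedge1 t al) w = - wedge1 t (wedge1 s al) w.
Proof.
elim: k al w => [|k IH] al w; first by rewrite /= oppr0.
have intE p q x (u : 'I_k -> T) : wedge1 p (wedge1 q al) (vcons x u) =
    p x * wedge1 q al u - q x * wedge1 p al u + wedge1 p (wedge1 q (interior x al)) u.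
  have := congr1 (fun f : xform T => f k u) (interior_wedge1 x p (wedge1 q al)).
  rewrite {1}/interior => ->; rewrite interior_wedge1 wedge1_xadd !wedge1_xscale.
  rewrite /xadd /xscale; ring.
rewrite (vcons_eta w) !intE IH; ring.
Qed.
End AlternatingForms.

(** * Clifford actions on alternating forms *)

Section CliffordAction.
Variables (R : realType) (V T : vectType R) (B : V -> V -> R).
Variable Pi : V -> xform T -> xform T.
Implicit Types (al be : xform T) (u v : V) (s t : clexpr V).
Hypothesis Bnd : nondeg_sym B.
Hypothesis Pi_alternating : forall v al, alternating al -> alternating (Pi v al).
Hypothesis Pi_xadd : forall v al be, Pi v (xadd al be) = xadd (Pi v al) (Pi v be).
Hypothesis Pi_xscale : forall a v al, Pi v (xscale a al) = xscale a (Pi v al).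
Hypothesis Pi_linear : forall a u v al, alternating al ->
  Pi (a *: u + v) al = xadd (xscale a (Pi u al)) (Pi v al).
Hypothesis Pi_clifford : forall u v al, alternating al ->
  xadd (Pi u (Pi v al)) (Pi v (Pi u al)) = xscale (B u v) al.

Local Notation act := (claction Pi).
Local Notation xz := (@xzero R T).

Let xext al be : (forall k w, al k w = be k w) -> al = be.
Proof. by move=> E; apply: functional_extensionality_dep => k; apply/funext => w. Qed.

Lemma claction_alternating t al : alternating al -> alternating (act t al).
Proof.
elim: t al => [a|v|s IHs t IHt|s IHs t IHt] al alA /=.
- exact: xscale_alternating.
- exact: Pi_alternating.
- by apply: xadd_alternating; [exact: IHs | exact: IHt].
- by apply: IHs; exact: IHt.
Qed.

Lemma claction_xadd t al be : act t (xadd al be) = xadd (act t al) (act t be).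
Proof.
elim: t al be => [a|v|s IHs t IHt|s IHs t IHt] al be /=.
- by apply: xext => k w; rewrite /xscale /xadd mulrDr.
- exact: Pi_xadd.
- by rewrite IHs IHt; apply: xext => k w; rewrite /xadd addrACA.
- by rewrite IHt IHs.
Qed.

Lemma claction_xscale a t al : act t (xscale a al) = xscale a (act t al).
Proof.
elim: t al => [b|v|s IHs t IHt|s IHs t IHt] al /=.
- by apply: xext => k w; rewrite /xscale mulrCA.
- exact: Pi_xscale.
- by rewrite IHs IHt; apply: xext => k w; rewrite /xadd /xscale mulrDr.
- by rewrite IHt IHs.
Qed.

(** The action descends to the Clifford algebra on alternating forms, where [Pi_linear] and
    [Pi_clifford] hold; the product case works because expressions preserve alternation. *)
Lemma cleq_claction s t al : cleq B s t -> alternating al -> act s al = act t al.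
Proof.
move=> st; elim: st al => {s t} /=.
- by [].
- by move=> s t _ IH al alA; rewrite IH.
- by move=> s t u _ IH1 _ IH2 al alA; rewrite IH1 // IH2.
- by move=> s s' t t' _ IH1 _ IH2 al alA; rewrite IH1 // IH2.
- move=> s s' t t' _ IH1 _ IH2 al alA; rewrite IH2 // IH1 //.
  exact: claction_alternating.
- by move=> s t u al _; apply: xext => k w; rewrite /xadd addrA.
- by move=> s t al _; apply: xext => k w; rewrite /xadd addrC.
- by move=> s al _; apply: xext => k w; rewrite /xadd /xscale mul0r add0r.
- by [].
- by move=> s al _; apply: xext => k w; rewrite /xscale mul1r.
- by move=> s al _; apply: xext => k w; rewrite /xscale !mul0r.
- by [].
- by move=> s t u al _; rewrite claction_xadd.
- by move=> a b al _; apply: xext => k w; rewrite /xadd /xscale mulrDl.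
- by move=> a b al _; apply: xext => k w; rewrite /xscale mulrA.
- by move=> a s al _; rewrite claction_xscale.
- by move=> a u v al alA; rewrite Pi_linear.
- by move=> u v al alA; rewrite Pi_clifford.
Qed.

Lemma Pi_xzero v : Pi v xz = xz.
Proof.
have -> : xz = xscale 0 xz by apply: xext => k w; rewrite /xscale mul0r.
by rewrite Pi_xscale; apply: xext => k w; rewrite /xscale !mul0r.
Qed.

Lemma Pi_anticomm u v al : alternating al -> B u v = 0 -> Pi u al = xz ->
  Pi u (Pi v al) = xz.
Proof.
move=> alA Buv Pu; have := Pi_clifford u v alA.
rewrite Buv Pu Pi_xzero => E; apply: xext => k w.
have := congr1 (fun f : xform T => f k w) E.
by rewrite /xadd /xscale mul0r addr0.
Qed.

Lemma Pi_clprod_orth e (b : seq V) phi : alternating phi -> Pi e phi = xz ->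
  (forall v, v \in b -> B e v = 0) -> Pi e (act (clprod b) phi) = xz.
Proof.
move=> phiA ePhi; elim: b => [_|v b IH eb] /=.
  by rewrite Pi_xscale ePhi; apply: xext => k w; rewrite /xscale mulr0.
apply: Pi_anticomm; first exact: claction_alternating.
  by apply: eb; rewrite mem_head.
by apply: IH => w wb; apply: eb; rewrite in_cons wb orbT.
Qed.

Lemma Pi_clprod_mem e (b : seq V) phi : alternating phi -> e \in b ->
  (forall v, v \in b -> B e v = 0) -> Pi e (act (clprod b) phi) = xz.
Proof.
move=> phiA; elim: b => [//|v b IH] /= eb Bb.
have alt := claction_alternating (clprod b) phiA.
have [ev|ev] := eqVneq e v.
  (* Where e meets itself, the Clifford relation says that twice its square is B e e = 0. *)
  rewrite -ev; have := Pi_clifford e e alt.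
  rewrite Bb // => E; apply: xext => k w; apply/eqP.
  have := congr1 (fun f : xform T => f k w) E.
  by rewrite /xadd /xscale mul0r -mulr2n => /eqP; rewrite mulrn_eq0.
apply: Pi_anticomm => //; first by apply: Bb; rewrite mem_head.
apply: IH; first by move: eb; rewrite in_cons (negbTE ev).
by move=> w wb; apply: Bb; rewrite in_cons wb orbT.
Qed.

Lemma Pi_span (b : seq V) al e : alternating al ->
  (forall v, v \in b -> Pi v al = xz) -> e \in <<b>>%VS -> Pi e al = xz.
Proof.
move=> alA Pb /(coord_span (X := in_tuple b)) ->.
have P0 : Pi 0 al = xz.
  have := Pi_linear (- 1) 0 0 alA; rewrite scaleN1r addNr => ->.
  by apply: xext => k w; rewrite /xadd /xscale mulN1r addNr.
elim/big_rec: _ => // i x _ Px; rewrite Pi_linear // Px Pb ?mem_nth //.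
by apply: xext => k w; rewrite /xadd /xscale mulr0 addr0.
Qed.

Variables (L D : {vspace V}).
Hypothesis L_lagr : L = orth B L.
Hypothesis LD0 : (L :&: D = 0)%VS.

(* A free family in D has a dual family in L, because D embeds into L^*. *)
Lemma dual_vector v (b : seq V) : free (v :: b) -> {subset v :: b <= D} ->
  exists l, [/\ l \in L, B l v = 1 & forall w, w \in b -> B l w = 0].
Proof.
rewrite free_cons => /andP[vb fb] bD; apply: contrapT => nol.
have bspan : (<<b>> <= D)%VS.
  by apply/span_subvP => w wb; apply: bD; rewrite in_cons wb orbT.
(* Without a dual vector, v is orthogonal to L cap b^perp, since a nonzero pairing could be rescaled
   to 1. So v lies in L + span b, and L cap D = 0 forces v into span b, against freeness. *)
have : v \in orth B (L :&: orth B <<b>>).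
  apply/(mem_orth Bnd) => l /memv_capP[lL /(mem_orth Bnd) lb].
  apply: contrapT => /eqP Bvl; apply: nol; exists ((B v l)^-1 *: l); split.
  - exact: memvZ.
  - by rewrite (formZl Bnd) (form_sym Bnd l) mulVf.
  - by move=> w wb; rewrite (formZl Bnd) lb ?mulr0 // memv_span.
have -> : (L :&: orth B <<b>>)%VS = orth B (L + <<b>>).
  by rewrite (orth_add Bnd) -L_lagr.
rewrite (orthK Bnd) => /memv_addP[l lL [w wb vE]].
have l0 : l = 0.
  apply/eqP; rewrite -memv0 -LD0 memv_cap lL /=.
  have -> : l = v - w by rewrite vE addrK.
  by rewrite memvB //; [apply: bD; rewrite mem_head | exact: (subvP bspan)].
by move/negP: vb; apply; rewrite vE l0 add0r.
Qed.

Lemma clprod_neq0 (b : seq V) phi : alternating phi ->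
  (forall l, l \in L -> Pi l phi = xz) -> free b -> {subset b <= D} ->
  phi <> xz -> act (clprod b) phi <> xz.
Proof.
move=> phiA Lphi fb bD phi0; elim: b fb bD => [|v b IH] fb bD /=.
  move=> E; apply: phi0; rewrite -E; apply: xext => k w.
  by rewrite /xscale mul1r.
move=> E; have [l [lL lv lb]] := dual_vector fb bD.
have fb' : free b by move: fb; rewrite free_cons => /andP[].
apply: (IH fb') => [w wb|]; first by apply: bD; rewrite in_cons wb orbT.
have alt := claction_alternating (clprod b) phiA.
(* As l kills the shorter product psi, the Clifford relation reads Pi l (Pi v psi) = psi, whose left
   side vanishes by [E]. *)
have := Pi_clifford l v alt; rewrite E (Pi_clprod_orth phiA (Lphi l lL) lb).
rewrite !Pi_xzero lv => Exz; apply: xext => k w.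
have := congr1 (fun f : xform T => f k w) Exz.
by rewrite /xadd /xscale mul1r addr0 => <-.
Qed.

Hypothesis D_isotropic : isotropic B D.

Lemma in_det_annihilates t phi e : in_det B D t -> alternating phi ->
  (forall l, l \in L -> Pi l phi = xz) -> e \in (L :&: orth B D + D)%VS ->
  Pi e (act t phi) = xz.
Proof.
move=> [a [b [bD tE]]] phiA Lphi; rewrite (cleq_claction tE) //=.
have alt := claction_alternating (clprod b) phiA.
have bsub v : v \in b -> v \in D by exact: basis_mem.
move=> /memv_addP[l /memv_capP[lL /(mem_orth Bnd) lD] [d dD ->]].
rewrite Pi_xscale -{1}[l]scale1r Pi_linear //.
rewrite (Pi_clprod_orth phiA (Lphi l lL)); last by move=> v /bsub; exact: lD.
rewrite (@Pi_span b) //; last by rewrite (span_basis bD).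
  by apply: xext => k w; rewrite /xadd /xscale !mulr0 addr0 mulr0.
move=> v vb; apply: Pi_clprod_mem => // w wb.
by apply: D_isotropic; apply: bsub.
Qed.

Lemma in_det_claction_neq0 t phi : in_det B D t -> ~ cleq B t (ClScal V 0) ->
  alternating phi -> (forall l, l \in L -> Pi l phi = xz) -> phi <> xz ->
  act t phi <> xz.
Proof.
move=> [a [b [bD tE]]] t0 phiA Lphi phi0; rewrite (cleq_claction tE) //= => E.
apply: (clprod_neq0 phiA Lphi (basis_free bD) _ phi0); first by move=> v; exact: basis_mem.
have a0 : a != 0.
  apply/eqP => a0; apply: t0; rewrite a0 in tE.
  exact: cleq_trans tE (cleq_mul0 _ _).
apply: xext => k w; have := congr1 (fun f : xform T => f k w) E.
by rewrite /xscale /xzero => /eqP; rewrite mulf_eq0 (negbTE a0) => /eqP.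
Qed.
End CliffordAction.

Lemma vcons_sum (R : realType) (T : vectType R) (al : xform T) k (I : Type)
    (r : seq I) (c : I -> R) (e : I -> T) (w : 'I_k -> T) : alternating al ->
  al k.+1 (vcons (\sum_(i <- r) c i *: e i) w) =
    \sum_(i <- r) c i * al k.+1 (vcons (e i) w).
Proof.
move=> /(_ k.+1)[lin _].
have linv a x y : al k.+1 (vcons (a *: x + y) w) =
    a * al k.+1 (vcons x w) + al k.+1 (vcons y w).
  by have := lin (vcons 0 w) ord0 a x y; rewrite !upd_vcons0.
elim: r => [|i r IH]; last by rewrite !big_cons linv IH.
have := linv (- 1) 0 0; rewrite !big_nil scaleN1r addNr => ->.
by rewrite mulN1r addNr.
Qed.

Section SpinorAction.
Variables (R : realType) (n m : nat) (M : manifold R n) (E : exactCourant M m).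
Variable nab : forall x : M, 'Hom('rV[R]_n, E x).
Hypothesis nab_split : isotropic_splitting nab.

Let Bnd x : nondeg_sym (@cform _ _ _ _ E x). Proof. exact: courant_form. Qed.

Lemma snab_decomposition x (e : E x) :
  e = nab x (anchor E x e) + pstar E x (snab nab e).
Proof.
have [_ pnab _] := nab_split.
rewrite /snab; case: xgetP => [s _ //|nos].
have [s sE] : exists s, e - nab x (anchor E x e) = pstar E x s.
  by apply: (courant_exact_m _).1; rewrite linearB /= pnab subrr.
by case: (nos s); rewrite /= -sE addrC subrK.
Qed.

(** The image of [nab] is isotropic, so only the p^* part of e pairs with it. This replaces the
    chosen covector by a formula from which linearity and smoothness are read off. *)
Lemma snabE x (e : E x) w : snab nab e w = cform e (nab x w).
Proof.
have [_ pnab nabi] := nab_split.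
rewrite {2}(snab_decomposition e) (formDl (Bnd x)) nabi add0r pstarP.
by rewrite pnab.
Qed.

Lemma snab_linear x a (u v : E x) : snab nab (a *: u + v) = a *: snab nab u + snab nab v.
Proof.
apply/lfunP => w; rewrite add_lfunE scale_lfunE !snabE.
by rewrite (form_linearl (Bnd x)).
Qed.

Lemma cform_snab x (u v : E x) :
  cform u v = snab nab u (anchor E x v) + snab nab v (anchor E x u).
Proof.
rewrite {1}(snab_decomposition u) (formDl (Bnd x)) pstarP addrC.
by congr (_ + _); rewrite (form_sym (Bnd x)) snabE.
Qed.

Lemma Pinab_alternating x (e : E x) al : alternating al -> alternating (Pinab nab e al).
Proof.
move=> alA; apply: xadd_alternating; first exact: interior_alternating.
exact: wedge1_alternating.
Qed.

Lemma Pinab_xadd x (e : E x) al be :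
  Pinab nab e (xadd al be) = xadd (Pinab nab e al) (Pinab nab e be).
Proof.
rewrite /Pinab wedge1_xadd; apply: functional_extensionality_dep => k.
by apply/funext => w; rewrite /xadd /interior addrACA.
Qed.

Lemma Pinab_xscale x a (e : E x) al :
  Pinab nab e (xscale a al) = xscale a (Pinab nab e al).
Proof.
rewrite /Pinab wedge1_xscale; apply: functional_extensionality_dep => k.
by apply/funext => w; rewrite /xadd /xscale /interior mulrDr.
Qed.

Lemma Pinab_linear x a (u v : E x) al : alternating al ->
  Pinab nab (a *: u + v) al = xadd (xscale a (Pinab nab u al)) (Pinab nab v al).
Proof.
move=> alA; rewrite /Pinab snab_linear linearP interior_linear // wedge1_linear.
apply: functional_extensionality_dep => k; apply/funext => w.
by rewrite /xadd /xscale mulrDr addrACA.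
Qed.

(** The pure contractions and the pure wedges anticommute; the mixed terms leave s_nab(v)(p u) +
    s_nab(u)(p v), which is the form. *)
Lemma Pinab_clifford x (u v : E x) al : alternating al ->
  xadd (Pinab nab u (Pinab nab v al)) (Pinab nab v (Pinab nab u al)) =
    xscale (cform u v) al.
Proof.
move=> alA; apply: functional_extensionality_dep => k; apply/funext => w.
rewrite /Pinab !interior_xadd !interior_wedge1 !wedge1_xadd cform_snab.
rewrite /xadd /xscale.
have := interior_anticomm (anchor E x u) (anchor E x v) w alA.
have := wedge1_anticomm (snab nab u) (snab nab v) al w.
by move=> -> ->; ring.
Qed.

Lemma smooth_forms_Pinab A (phi : M -> xform 'rV[R]_n) (s : forall x, E x) :
  smooth_forms A phi -> (forall x, A x -> alternating (phi x)) ->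
  smooth_section A s -> smooth_forms A (fun x => Pinab nab (s x) (phi x)).
Proof.
move=> sphi phiA ss t tT k ix.
have [E_lbij E_cover _] := courant_bundle E.
have [snabm _ _] := nab_split.
pose fr x a : 'rV[R]_n := tframe t a x.
have sp : smooth_section (E := tangent_bundle M) A (fun x => anchor E x (s x)).
  apply: (smooth_morphism_section (F := tangent_bundle M)) => //.
    exact: tangent_bundle_open.
  exact: courant_anchor_smooth.
have spc j : smooth_on (A `&` tdom t) (fun x => tcoord t x (anchor E x (s x)) 0 j).
  exact: sp.
have snabf a : smooth_section (A `&` tdom t) (fun x => nab x (fr x a)).
  move=> t' t'E j; apply: smooth_fun_smooth_on (snabm t t' tT t'E a j).
    by apply: openI; [exact: tangent_bundle_open | exact: (E_lbij t' t'E).1].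
  by move=> y [[]].
have ss' : smooth_section (A `&` tdom t) s by apply: smooth_section_subset ss => y [].
rewrite /Pinab /xadd; apply: smooth_onD.
  (* [jx j] prepends j to the multi-index: contraction becomes a sum over the components of the
     anchor in the coordinate frame. *)
  pose jx j : 'I_k.+1 -> 'I_n := fun a => if unlift ord0 a is Some b then ix b else j.
  have : smooth_on (A `&` tdom t) (fun x => \sum_j
      tcoord t x (anchor E x (s x)) 0 j * phi x k.+1 (fun a => fr x (jx j a))).
    by apply: smooth_on_sum => j _; apply: smooth_onM => //; exact: sphi.
  apply: eq_smooth_on => x [Ax tx].
  rewrite /interior.
  have tb := tangent_bundle_lbij tT tx.
  rewrite [in RHS](tframe_expand (t := t) (anchor E x (s x)) tb).
  rewrite (vcons_sum _ _ _ _ (phiA x Ax)); apply: eq_bigr => j _.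
  congr (_ * phi x k.+1 _); apply/funext => a.
  by rewrite /vcons /jx; case: unlift.
case: k ix => [|k] ix; first exact: smooth_on_cst.
apply: smooth_on_sum => i _; apply: smooth_onM; last exact: sphi.
apply: smooth_onM; first exact: smooth_on_cst.
have : smooth_on (A `&` tdom t) (fun x => cform (s x) (nab x (fr x (ix i)))).
  exact: cform_smooth.
by apply: eq_smooth_on => x _; rewrite snabE.
Qed.

Local Notation act x := (claction (@Pinab _ _ _ _ E nab x)).

Lemma claction_Pinab_alternating x t al : alternating al ->
  alternating (act x t al).
Proof. by apply: claction_alternating => v be; exact: Pinab_alternating. Qed.

Lemma smooth_forms_clprod A (phi : M -> xform 'rV[R]_n) (I : Type) (r : seq I)
    (s : I -> forall x, E x) :
  smooth_forms A phi -> (forall x, A x -> alternating (phi x)) ->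
  (forall i, smooth_section A (s i)) ->
  smooth_forms A (fun x => act x (clprod [seq s i x | i <- r]) (phi x)).
Proof.
move=> sphi phiA ss; elim: r => [|i r IH] /=.
  move=> t tT k ix; apply: eq_smooth_on (sphi t tT k ix) => x _.
  by rewrite /xscale mul1r.
apply: smooth_forms_Pinab => // x Ax.
by apply: claction_Pinab_alternating; exact: phiA.
Qed.

(** [dd] consists of Clifford expressions meaningful only up to [cleq]; smoothness is obtained from
    the local representative f s_1 ... s_r, which acts in the same way on alternating forms. *)
Lemma nz_section_U_claction (A : set M) (L D : forall x, {vspace E x}) phi dd :
  (forall x, A x -> L x = perp L x) -> (forall x, A x -> (L x :&: D x = 0)%VS) ->
  isotropic_on A D -> nz_section_U nab A L phi -> nz_section_det A D dd ->
  nz_section_U nab A (fun x => (L x :&: perp D x + D x)%VS)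
    (fun x => act x (dd x) (phi x)).
Proof.
move=> LL LD0 DD [sphi Uphi] [ddP ddloc].
have phiA x : A x -> alternating (phi x) by move=> /Uphi[[]].
split.
  move=> t tT k ix; apply: smooth_on_local => x [Ax tx].
  have [W [r [s [f [oW Wx [ss sb] sf ddE]]]]] := ddloc x Ax.
  exists W; split=> //.
  have := smooth_forms_clprod (enum 'I_r) (A := A `&` W) (phi := phi) (s := s) _ _ ss.
  have sphiW : smooth_forms (A `&` W) phi.
    by move=> t' t'T l jx; apply: smooth_on_subset (sphi t' t'T l jx) => y [[]].
  have phiAW y : (A `&` W) y -> alternating (phi y) by move=> [/phiA].
  move=> /(_ sphiW phiAW t tT k ix) sprod.
  have AWt : A `&` tdom t `&` W `<=` A `&` W `&` tdom t by move=> y [[]].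
  have sf' : smooth_on (A `&` tdom t `&` W) f by apply: smooth_on_subset sf => y [[]].
  apply: eq_smooth_on (smooth_onM sf' (smooth_on_subset AWt sprod)) => y [[Ay ty] Wy].
  by rewrite (cleq_claction (@Pinab_alternating y) (@Pinab_xadd y) (@Pinab_xscale y)
    (@Pinab_linear y) (@Pinab_clifford y) (ddE y Ay Wy)) //; exact: phiA.
move=> x Ax; have [phU phi0] := Uphi x Ax; have [_ Lphi] := phU.
have [indet dd0] := ddP x Ax.
split; first split.
- by apply: claction_Pinab_alternating; exact: phiA.
- move=> e; apply: (in_det_annihilates (Bnd x) (@Pinab_alternating x) (@Pinab_xadd x)
    (@Pinab_xscale x) (@Pinab_linear x) (@Pinab_clifford x) (DD x Ax) indet) => //.
  exact: phiA.
- apply: (in_det_claction_neq0 (Bnd x) (@Pinab_alternating x) (@Pinab_xadd x)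
    (@Pinab_xscale x) (@Pinab_linear x) (@Pinab_clifford x) (LL x Ax) (LD0 x Ax) indet) => //.
  exact: phiA.
Qed.
End SpinorAction.

(** * Frames of L_D *)

Section FamilyBasis.
Variables (K : fieldType) (V : vectType K) (U : {vspace V}) (r : nat).
Variable s : 'I_r -> V.

Lemma family_basisP : basis_of U [seq s i | i <- enum 'I_r] <->
  [/\ forall i, s i \in U,
      forall c : 'I_r -> K, \sum_i c i *: s i = 0 -> forall i, c i = 0 &
      \dim U = r].
Proof.
pose X := [tuple s i | i < r].
have Xi (i : 'I_r) : X`_i = s i by rewrite -tnth_nth tnth_mktuple.
have EX : [seq s i | i <- enum 'I_r] = X by [].
have frE : free X <-> forall c : 'I_r -> K, \sum_i c i *: s i = 0 -> forall i, c i = 0.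
  split=> [/freeP frX c cs|frs]; last apply/freeP => c cs.
    by apply: frX; rewrite -[RHS]cs; apply: eq_bigr => i _; rewrite Xi.
  by apply: frs; rewrite -[RHS]cs; apply: eq_bigr => i _; rewrite Xi.
rewrite EX; split=> [bX|[sU frs dU]].
  split=> [i||].
  - by rewrite -Xi; apply: (basis_mem bX); rewrite mem_nth // size_tuple.
  - exact/frE/(basis_free bX).
  - by rewrite -(size_basis bX) ?size_tuple.
rewrite basisEfree (frE.2 frs) dU size_tuple leqnn andbT /=.
by apply/span_subvP => v /mapP[i _ ->].
Qed.

Lemma family_basis_span v : basis_of U [seq s i | i <- enum 'I_r] -> v \in U ->
  exists c : 'I_r -> K, v = \sum_i c i *: s i.
Proof.
move=> bX vU; pose X := [tuple s i | i < r].
exists (fun i => coord X i v); rewrite {1}(coord_basis (X := X) bX vU).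
by apply: eq_bigr => i _; rewrite -tnth_nth tnth_mktuple.
Qed.
End FamilyBasis.

Lemma left_kernel_basis (K : fieldType) (p q : nat) (C : 'M[K]_(p, q)) : row_full C ->
  exists F : 'M[K]_(p - q, p), row_free F /\ F *m C = 0.
Proof.
move=> /eqP rC; have rk : \rank (kermx C) = (p - q)%N by rewrite mxrank_ker rC.
(* The number of rows is kept as a rank until the end, because it occurs in the type of F. *)
have : exists F : 'M[K]_(\rank (kermx C), p), row_free F /\ F *m C = 0.
  exists (row_base (kermx C)); split; first exact: row_base_free.
  by apply/sub_kermxP; rewrite eq_row_base.
by rewrite rk.
Qed.

Section PerturbedFrame.
Variables (R : realType) (n m : nat) (M : manifold R n) (E : exactCourant M m).
Variables (N : set M) (L D : forall x : M, {vspace E x}).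
Hypothesis L_sub : subbundle N L.
Hypothesis L_lagr : forall x, N x -> L x = perp L x.
Hypothesis D_sub : subbundle N D.
Hypothesis LD0 : forall x, N x -> (L x :&: D x = 0)%VS.
Hypothesis LD_lagr : forall x, N x ->
  (L x :&: perp D x + D x)%VS = perp (fun y => L y :&: perp D y + D y)%VS x.

Let Bnd x : nondeg_sym (@cform _ _ _ _ E x). Proof. exact: courant_form. Qed.

(* With C the pairing matrix of frames of L and D and P a constant left inverse
   of C at x, the projection 1 - C (P C)^-1 P maps a basis of the kernel of C
   at x to bases of the kernels of C at the points near x. *)
Lemma perturbed_subbundle : subbundle N (fun x => L x :&: perp D x + D x)%VS.
Proof.
have [rL L_frame] := L_sub; have [rD D_frame] := D_sub.
exists (rL - rD + rD)%N => x Nx.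
have [W1 [l [oW1 W1x [ls lb]]]] := L_frame x Nx.
have [W2 [e [oW2 W2x [es eb]]]] := D_frame x Nx.
pose C y : 'M[R]_(rL, rD) := \matrix_(i, j) cform (l i y) (e j y).
(* A combination of the frame of D that pairs to zero with the frame of L lies in L^perp cap D = L
   cap D = 0. *)
have C_full y : N y -> W1 y -> W2 y -> row_full (C y).
  move=> Ny W1y W2y; rewrite /row_full -mxrank_tr; apply: inj_row_free => a aC.
  have [eD efree _] := (family_basisP _ _).1 (eb y Ny W2y).
  apply/rowP => j; rewrite mxE; apply: (efree (fun j => a 0 j)).
  apply/eqP; rewrite -memv0 -(LD0 Ny) memv_cap; apply/andP; split; last first.
    by apply: rpred_sum => i _; apply: rpredZ; exact: eD.
  rewrite L_lagr //; apply/(mem_orth (Bnd y)) => w wL.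
  have [c ->] := family_basis_span (lb y Ny W1y) wL.
  rewrite (form_sumr (Bnd y)) big1 // => i _; rewrite (formZr (Bnd y)).
  have : (a *m (C y)^T) 0 i = 0 by rewrite aC mxE.
  rewrite mxE (form_suml (Bnd y)) => aC0; rewrite [X in _ * X](_ : _ = 0) ?mulr0 //.
  rewrite -[RHS]aC0; apply: eq_bigr => q _.
  by rewrite !mxE (formZl (Bnd y)) (form_sym (Bnd y)).
have C_smooth i j : smooth_on (N `&` (W1 `&` W2)) (fun y => C y i j).
  have : smooth_on (N `&` (W1 `&` W2)) (fun y => cform (l i y) (e j y)).
    by apply: cform_smooth; [apply: smooth_section_subset (ls i) |
       apply: smooth_section_subset (es j)] => y [Ny []].
  by apply: eq_smooth_on => y _; rewrite mxE.
have Cx := C_full x Nx W1x W2x.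
pose P := pinvmx (C x); have PC : P *m C x = 1%:M by exact: mulVpmx.
have PC_smooth i j : smooth_on (N `&` (W1 `&` W2)) (fun y => (P *m C y) i j).
  by apply: smooth_on_mulmx => // *; exact: smooth_on_cst.
have [W3 [oW3 W3x PC_det]] : exists W, [/\ open W, W x &
    forall y, (N `&` (W1 `&` W2)) y -> W y -> \det (P *m C y) != 0].
  apply: smooth_on_near_neq0; [exact: smooth_on_det | by [] |].
  by rewrite PC det1 oner_neq0.
have [F [Ffree FC]] := left_kernel_basis Cx.
pose Q y : 'M[R]_rL := 1%:M - C y *m invmx (P *m C y) *m P.
pose s (i : 'I_(rL - rD + rD)) y : E y := match fintype.split i with
  | inl i1 => \sum_j (F *m Q y) i1 j *: l j y
  | inr i2 => e i2 y
  end.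
pose W := W1 `&` W2 `&` W3.
have oW : open W by apply: openI => //; exact: openI.
exists W, s; split=> //; split=> [i|y Ny [[W1y W2y] W3y]].
  rewrite /s; case: (fintype.split i) => i'; last first.
    by apply: smooth_section_subset (es i') => y [Ny [[]]].
  apply: smooth_section_sum => j; apply: smooth_sectionZ; last first.
    by apply: smooth_section_subset (ls j) => y [Ny [[]]].
  have NW : N `&` W `<=` N `&` (W1 `&` W2) by move=> y [Ny [[]]].
  apply: smooth_on_mulmx => [*|i1 j1]; first exact: smooth_on_cst.
  have : smooth_on (N `&` W)
      (fun y => (1%:M : 'M[R]_rL) i1 j1 + - (C y *m invmx (P *m C y) *m P) i1 j1).
    apply: smooth_onD; first exact: smooth_on_cst.
    apply: smooth_onN; apply: smooth_on_mulmx => [i2 j2|*]; last exact: smooth_on_cst.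
    apply: smooth_on_mulmx => [i3 j3|]; first exact: smooth_on_subset (C_smooth i3 j3).
    apply: smooth_on_invmx => [y [Ny [[W1y W2y] W3y]]|i3 j3].
      by rewrite unitmxE unitfE PC_det.
    exact: smooth_on_subset (PC_smooth i3 j3).
  by apply: eq_smooth_on => y _; rewrite !mxE.
have PCu : P *m C y \in unitmx by rewrite unitmxE unitfE PC_det.
have QC : Q y *m C y = 0.
  rewrite mulmxBl mul1mx -(mulmxA (C y *m _)) -(mulmxA (C y)).
  by rewrite mulVmx // mulmx1 subrr.
have [lL lfree dL] := (family_basisP _ _).1 (lb y Ny W1y).
have [eD efree dD] := (family_basisP _ _).1 (eb y Ny W2y).
apply/family_basisP; split.
- move=> i; rewrite /s; case: (fintype.split i) => i'; last exact: (subvP (addvSr _ _)).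
  apply: (subvP (addvSl _ _)); rewrite memv_cap.
  rewrite rpred_sum /=; last by move=> j _; apply: rpredZ; exact: lL.
  apply/(mem_orth (Bnd y)) => w wD.
  have [c ->] := family_basis_span (eb y Ny W2y) wD.
  rewrite (form_sumr (Bnd y)) big1 // => j _; rewrite (formZr (Bnd y)).
  have : (F *m Q y *m C y) i' j = 0 by rewrite -mulmxA QC mulmx0 mxE.
  rewrite mxE (form_suml (Bnd y)) => FQC; rewrite [X in _ * X](_ : _ = 0) ?mulr0 //.
  by rewrite -[RHS]FQC; apply: eq_bigr => q _; rewrite (formZl (Bnd y)) [C y _ _]mxE.
- move=> c; rewrite big_split_ord /=.
  under eq_bigr do rewrite /s (unsplitK (inl _)).
  under [X in _ + X]eq_bigr do rewrite /s (unsplitK (inr _)).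
  set u := \sum_(i < rL - rD) _; set v := \sum_(i < rD) _ => uv0.
  have uL : u \in L y.
    by apply: rpred_sum => i _; apply: rpredZ; apply: rpred_sum => j _; exact: rpredZ.
  have vD : v \in D y by apply: rpred_sum => i _; apply: rpredZ.
  have uv : u = - v by apply/eqP; rewrite -addr_eq0 uv0.
  have u0 : u = 0.
    by apply/eqP; rewrite -memv0 -(LD0 Ny) memv_cap uL uv rpredN vD.
  have v0 : v = 0 by apply/eqP; rewrite -oppr_eq0 -uv u0.
  pose a : 'rV[R]_(rL - rD) := \row_i c (lshift rD i).
  have aFQ : a *m F *m Q y = 0.
    apply/rowP => j; rewrite [RHS]mxE; apply: (lfree (fun j => (a *m F *m Q y) 0 j)).
    rewrite -[RHS]u0 /u; under [RHS]eq_bigr do rewrite scaler_sumr.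
    rewrite [RHS]exchange_big /=; apply: eq_bigr => q _.
    rewrite -mulmxA mxE scaler_suml; apply: eq_bigr => i _.
    by rewrite scalerA mxE.
  (* From a F Q = 0 one gets a F = z P with z = a F C(y) (P C(y))^-1. Multiplying by C(x), where P
     C(x) = 1 and F C(x) = 0, gives z = 0. *)
  have aF0 : a *m F = 0.
    move: aFQ; rewrite mulmxBr mulmx1 mulmxA => /eqP; rewrite subr_eq0 => /eqP aFE.
    have z0 : a *m F *m (C y *m invmx (P *m C y)) = 0.
      set z := a *m F *m _ in aFE *.
      by rewrite -[z]mulmx1 -PC mulmxA -aFE -mulmxA FC mulmx0.
    by rewrite aFE z0 mul0mx.
  have a0 : a = 0 by apply: (row_free_inj Ffree); rewrite aF0 mul0mx.
  move=> i; case: (split_ordP i) => j ->.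
    by have /rowP/(_ j) := a0; rewrite !mxE.
  exact: (efree (fun j => c (rshift _ j))).
(* Both L_D and L have half the fibre dimension, so L_D has rank rL. Full column rank gives rD <=
   rL, which makes the truncated subtraction in the rank exact. *)
- have dLD := lagrangian_dim (Bnd y) (LD_lagr Ny).
  have dLL := lagrangian_dim (Bnd y) (L_lagr Ny).
  have rank_le : (rD <= rL)%N by rewrite -(eqP (C_full y Ny W1y W2y)) rank_leq_row.
  by rewrite subnK //; move: dLD dLL; rewrite dL /perp; lia.
Qed.
End PerturbedFrame.

Lemma isometry_orth (R : realType) (V V' : vectType R) (B : V -> V -> R)
    (B' : V' -> V' -> R) (Phi : 'Hom(V, V')) (U : {vspace V}) :
  nondeg_sym B -> nondeg_sym B' -> lbij Phi ->
  (forall v w, B' (Phi v) (Phi w) = B v w) ->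
  (Phi @: orth B U)%VS = orth B' (Phi @: U).
Proof.
move=> Bnd Bnd' [_ Phi_img] iso; apply/vspaceP => v'; apply/idP/idP.
  case/memv_imgP => v /(mem_orth Bnd) vU ->.
  apply/(mem_orth Bnd') => _ /memv_imgP[w wU ->].
  by rewrite iso vU.
have : v' \in limg Phi by rewrite Phi_img memvf.
case/memv_imgP => v _ -> /(mem_orth Bnd') vU; apply: memv_img.
by apply/(mem_orth Bnd) => w wU; rewrite -iso; apply: vU; exact: memv_img.
Qed.

Theorem proposition3p11 (R : realType) (n m k d : nat)
  (M : manifold R n) (E : exactCourant M m)
  (G : lieGroup R k)
  (G_compact : compact [set: G]%classic) (G_connected : connected [set: G]%classic)
  (A : liftedAction E G) (A_isotropic : isotropic_action A)
  (N : set M) (N_submanifold : submanifold N d)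
  (N_invariant : invariant_set A N) (N_free : free_on A N)
  (L : forall x : M, {vspace E x})
  (L_dirac : dirac_structure L) (L_invariant : invariant_on A [set: M]%classic L)
  (LK_rank : constant_rank N (fun x => (L x :&: Kbundle A N d x)%VS))
  (D : forall x : M, {vspace E x})
  (D_input : perturbation_input A N L (Kbundle A N d) D) :
  let K := Kbundle A N d in
  let LD := fun x : M => (L x :&: perp D x + D x)%VS in
  [/\ lagrangian_on N LD,
      invariant_on A N LD /\ (forall x, N x -> (LD x :&: K x)%VS = 0%VS),
      forall x, N x ->
        (LD x :&: perp K x + K x)%VS = (L x :&: perp K x + K x)%VS &
      forall (nab : forall x : M, 'Hom('rV[R]_n, E x)),
        isotropic_splitting nab ->
      forall (V W : set M), open W -> V = (N `&` W)%classic ->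
      forall phi : M -> xform 'rV[R]_n, nz_section_U nab V L phi ->
      forall dd : (forall x : M, clexpr (E x)), nz_section_det V D dd ->
        nz_section_U nab V LD
          (fun x => claction (@Pinab _ _ _ _ E nab x) (dd x) (phi x))].
Proof.
move=> K LD.
have [[L_sub L_lagr] _] := L_dirac.
have [D_sub D_inv D_iso D_compl] := D_input.
have Bnd x : nondeg_sym (@cform _ _ _ _ E x) by exact: courant_form.
have K_iso : isotropic_on N K by exact: Kbundle_isotropic.
have LL x : L x = perp L x by exact: L_lagr.
have L_subN : subbundle N L.
  have [r Lr] := L_sub; exists r => x _; have [W [s [oW Wx [ss sb]]]] := Lr x I.
  exists W, s; split=> //; split=> [i|y _]; last exact: sb.
  by apply: smooth_section_subset (ss i) => y [].
have LD0 x : N x -> (L x :&: D x = 0)%VS.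
  by move=> /D_compl[_ cap0]; exact: (perturbation_capL (Bnd x) (LL x) cap0).
have LD_lagr x : N x -> LD x = perp LD x.
  by move=> Nx; exact: (perturbation_lagrangian (Bnd x) (LL x) (D_iso x Nx)).
split.
- by split=> //; exact: perturbed_subbundle.
- split=> [g x Nx|x Nx]; last first.
    have [span cap0] := D_compl x Nx.
    exact: (perturbation_capK (Bnd x) (LL x) span cap0 (K_iso x Nx)).
  have [_ [Act_bij _] Act_iso _ _] := lact_aut A g.
  have [Act_ker _] := Act_bij x.
  (* Images under [Act A g x] commute with sums, with intersections by injectivity, and with
     orthogonals because it is a bijective isometry. *)
  rewrite /LD limgD lker0_img_cap ?Act_ker // D_inv // L_invariant //.
  rewrite /perp (isometry_orth _ (Bnd x) (Bnd (act A g x)) (Act_bij x)) ?D_inv //.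
- move=> x Nx; have [_ cap0] := D_compl x Nx.
  exact: (perturbation_reduction (Bnd x) (LL x) cap0 (K_iso x Nx)).
- move=> nab nab_split V W oW VE phi Uphi dd det_dd.
  have VN x : V x -> N x by rewrite VE => -[].
  apply: (nz_section_U_claction nab_split) => // x Vx.
  + exact: LD0 (VN x Vx).
  + exact: D_iso (VN x Vx).
Qed.
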